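(* Let $X$ be a separable Banach space and let $F:[0,1]\to 2^{X}\setminus\{\varnothing\}$ be a compact-valued bounded multifunction. Then $I(F)$ is star-shaped, i.e. there exists $A_0\in I(F)$ such that for all $A\in I(F)$ and all $\lambda\in[0,1]$ one has $\lambda A_0+(1-\lambda)A\in I(F)$. (In particular, $I(F)$ is non-empty.)
   Context: For subsets $A,B$ of a Banach space $X$ and $\lambda\in\mathbb{R}$: $A+B=\{a+b: a\in A, b\in B\}$, $\lambda A=\{\lambda a: a\in A\}$. A tagged partition $(\Gamma,T)$ of $[0,1]$ consists of a partition $\Gamma=\{\Delta_i\}_{i=1}^n$ of $[0,1]$ into (non-overlapping closed) segments $\Delta_i=[a_i,b_i]$ and tags $T=\{\xi_i\}_{i=1}^n$, $\xi_i\in\Delta_i$. Write $|\Delta_i|=b_i-a_i$ and $d(\Gamma)=\max_i|\Delta_i|$. A multifunction is a map $F:[0,1]\to 2^X\setminus\{\varnothing\}$. It is bounded if $M(F)=\sup\{\|a\|: a\in F(t), t\in[0,1]\}<\infty$, and compact-valued if $F(t)$ is compact for every $t$. Its Riemann sums are $S(F,\Gamma,T)=\sum_{i=1}^n|\Delta_i|F(\xi_i)$ (Minkowski sum). The Hausdorff distance between non-empty sets is $d_H(A,B)=\max\{\sup_{a\in A}d(a,B),\sup_{b\in B}d(b,A)\}$. For bounded $F$, $I(F)$ is the collection of all non-empty closed subsets $A\subset X$ for which there is a sequence of tagged partitions $(\Gamma_k,T_k)$ with $d(\Gamma_k)\to0$ and $d_H(S(F,\Gamma_k,T_k),A)\to0$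 as $k\to\infty$. *)

(* Defs.v *)
From HB Require Import structures.
From mathcomp Require Import all_boot all_order all_algebra.
From mathcomp Require Import all_classical all_reals all_analysis.
Set Implicit Arguments.
Unset Strict Implicit.
Unset Printing Implicit Defensive.
Import Order.TTheory GRing.Theory Num.Theory.
Import numFieldNormedType.Exports.
Local Open Scope classical_set_scope.
Local Open Scope ring_scope.

Definition separable (T : topologicalType) : Prop :=
  exists2 D : set T, countable D & dense D.

Definition minkowski_add (V : zmodType) (A B : set V) : set V :=
  [set a + b | a in A & b in B].

Definition minkowski_scale (R : pzRingType) (V : lmodType R) (c : R)
  (A : set V) : set V := [set c *: a | a in A].

(* Extended-real valued, so that it is meaningful for unbounded sets too;
   only used for non-empty A and B. *)
Definition hausdorff_dist (R : realType) (X : pseudoMetricType R)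
  (A B : set X) : \bar R :=
  maxe (ereal_sup [set edist_inf B a | a in A])
       (ereal_sup [set edist_inf A b | b in B]).

(* [itv_partition 0 1 s] says that s = [:: x_1; ...; x_n] with
   0 < x_1 < ... < x_n = 1.  The segments are numbered from left to right:
   for i < n, the i-th one is [x_i, x_(i+1)], where x_0 = 0. *)
Record tagged_partition (R : realType) := TaggedPartition {
  tp_points : seq R ;
  tp_tag : 'I_(size tp_points) -> R ;
  tp_pointsP : itv_partition 0 1 tp_points ;
  tp_tagP : forall i : 'I_(size tp_points),
    nth 0 (0 :: tp_points) i <= tp_tag i <= nth 0 tp_points i }.

Definition seg_length (R : realType) (P : tagged_partition R)
  (i : 'I_(size (tp_points P))) : R :=
  nth 0 (tp_points P) i - nth 0 (0 :: tp_points P) i.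

Definition mesh (R : realType) (P : tagged_partition R) : R :=
  \big[Num.max/0]_(i < size (tp_points P)) seg_length i.

(* A multifunction on [0, 1] is represented by a map on R whose values outside
   [0, 1] are irrelevant: none of the definitions below looks at them. *)
Definition multifunction (R : realType) (X : normedModType R)
  (F : R -> set X) : Prop := forall t, 0 <= t <= 1 -> F t !=set0.

Definition compact_valued (R : realType) (X : normedModType R)
  (F : R -> set X) : Prop := forall t, 0 <= t <= 1 -> compact (F t).

Definition sup_norm (R : realType) (X : normedModType R)
  (F : R -> set X) : \bar R :=
  ereal_sup [set `|a|%:E | a in \bigcup_(t in [set t : R | 0 <= t <= 1]) F t].

Definition bounded_multifunction (R : realType) (X : normedModType R)
  (F : R -> set X) : Prop := (sup_norm F < +oo)%E.

Definition riemann_sum (R : realType) (X : normedModType R)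
  (F : R -> set X) (P : tagged_partition R) : set X :=
  \big[@minkowski_add X/[set 0]]_(i < size (tp_points P))
    minkowski_scale (seg_length i) (F (tp_tag i)).

Definition riemann_limits (R : realType) (X : normedModType R)
  (F : R -> set X) : set (set X) :=
  [set A | [/\ A !=set0, closed A &
    exists P : nat -> tagged_partition R,
      mesh (P k) @[k --> \oo] --> (0 : R) /\
      hausdorff_dist (riemann_sum F (P k)) A @[k --> \oo] --> 0%E]].

Definition star_shaped (R : realType) (X : normedModType R)
  (C : set (set X)) : Prop :=
  exists2 A0 : set X, C A0 &
    forall A : set X, C A -> forall l : R, 0 <= l <= 1 ->
      C (minkowski_add (minkowski_scale l A0) (minkowski_scale (1 - l) A)).

(* Main.v *)
Require Import Defs.
From mathcomp Require Import all_boot all_order all_algebra.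
From mathcomp Require Import all_classical all_reals all_analysis.
From mathcomp Require Import finmap measurable_realfun ring lra.
Set Implicit Arguments.
Unset Strict Implicit.
Unset Printing Implicit Defensive.
Import Order.TTheory GRing.Theory Num.Theory.
Import numFieldNormedType.Exports.
Local Open Scope classical_set_scope.
Local Open Scope ring_scope.

(** Separability makes the compact subsets of X separable for the Hausdorff
    distance: finite sets v_j of points of a dense sequence are dense among
    them.  Although F is arbitrary, it admits measurable approximations: for
    every m there is a measurable label g_m such that the set of the t at which
    F(t) is 2^-m-close to v_(g_m(t)), simultaneously for all the labels up to
    any given order, meets every measurable set of positive measure.  By Lusin's
    theorem g_m is locally constant on a set K_m of measure at least 1 - 2^-m,
    so that a short segment which meets K_m has a label c; attach to it the
    convex set conv v_c.  The sums of these convex sets over fine partitions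
    form a Cauchy family, whose limit is A_0.

    Given a fine tagged partition with Riemann sum S, shrink each segment
    around its tag by the factor 1 - l.  This contributes exactly (1 - l) S.
    Cut the freed intervals into many equal pieces, tagged where F is close
    to v_c: averaging many copies of v_c convexifies it, and these pieces
    contribute almost l A_0. *)

(** * Sets of full outer measure and measurable labels *)

Section unit_measure.
Variable R : realType.
Implicit Types A B D S T : set R.

Let I01 : set R := `]0, 1]%classic.

(** The interval is half-open like the pieces []a, b]] of a partition, so that consecutive pieces
    are disjoint and their measures add up exactly. *)
Definition unit_measure A : R := fine (lebesgue_measure (A `&` I01)).
Local Notation nu := unit_measure.

Let mI01 : measurable I01. Proof. exact: measurable_itv. Qed.

Let mu_fin A : measurable A -> lebesgue_measure (A `&` I01) \is a fin_num.
Proof.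
move=> mA; rewrite ge0_fin_numE//.
apply: (@le_lt_trans _ _ (lebesgue_measure I01)).
  by apply: le_measure; [apply: mem_set; exact: measurableI|exact: mem_set|].
by rewrite /I01 lebesgue_measure_itv/= lte01 -EFinB ltry.
Qed.

Lemma unit_measure_ge0 A : 0 <= nu A.
Proof. by rewrite fine_ge0. Qed.

Lemma unit_measureU A B : measurable A -> measurable B -> A `&` B = set0 ->
  nu (A `|` B) = nu A + nu B.
Proof.
move=> mA mB AB; rewrite /nu setIUl measureU//; try exact: measurableI.
  by rewrite fineD// mu_fin.
by rewrite setIACA setIid AB set0I.
Qed.

Lemma unit_measure_split A B : measurable A -> measurable B ->
  nu A = nu (A `&` B) + nu (A `\` B).
Proof.
move=> mA mB; rewrite -unit_measureU.
- by rewrite setUIDK.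
- exact: measurableI.
- exact: measurableD.
- by rewrite setDE setIACA setICr setI0.
Qed.

Lemma le_unit_measure A B : measurable A -> measurable B ->
  A `<=` B -> nu A <= nu B.
Proof.
move=> mA mB AB; rewrite (unit_measure_split mB mA) setIC.
by rewrite (setIidl AB) lerDl unit_measure_ge0.
Qed.

Lemma unit_measure_itv a b : 0 <= a -> a <= b -> b <= 1 ->
  nu `]a, b]%classic = b - a.
Proof.
move=> a0 ab b1; rewrite /nu setIidl; last first.
  by move=> x; rewrite /I01/= !in_itv/= => /andP[ax xb]; apply/andP; split; lra.
rewrite lebesgue_measure_itv/= lte_fin; case: ltP => //= ba.
by apply/esym/eqP; rewrite subr_eq0 eq_le ab ba.
Qed.

Lemma unit_measure0 : nu set0 = 0.
Proof. by rewrite /nu set0I measure0. Qed.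

Lemma unit_measure_bigcup0 (A : nat -> set R) : (forall n, measurable (A n)) ->
  (forall n, nu (A n) = 0) -> nu (\bigcup_n A n) = 0.
Proof.
move=> mA A0; rewrite /nu setI_bigcupl.
suff -> : (@lebesgue_measure R (\bigcup_n (A n `&` I01)) = 0)%E by [].
have mAI k : measurable (A k `&` I01) by exact: measurableI.
have mAI' : measurable (\bigcup_n (A n `&` I01)) by exact: bigcup_measurable.
apply: (iffLR (negligibleP lebesgue_measure mAI')).
apply: negligible_bigcup => k; apply: (iffRL (negligibleP lebesgue_measure (mAI k))).
by rewrite -[LHS]fineK ?mu_fin//; congr (_%:E); exact: A0.
Qed.

(** Intersect measurable supersets of [S] whose measures tend to the infimum. The result is a
    measurable envelope of an arbitrary set, minimal up to null sets. *)
Lemma measurable_hull S : exists h, [/\ measurable h, S `<=` h &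
  forall D, measurable D -> D `<=` h -> D `&` S = set0 -> nu D = 0].
Proof.
pose E := [set nu A | A in [set A | measurable A /\ S `<=` A]].
have E0 : E !=set0 by exists (nu setT), setT.
have infE : has_inf E.
  by split => //; exists 0 => _ [A _ <-]; exact: unit_measure_ge0.
have /choice[A AP] : forall n : nat, exists A,
    [/\ measurable A, S `<=` A & nu A < inf E + n.+1%:R^-1].
  move=> n; have n0 : 0 < n.+1%:R^-1 :> R by rewrite invr_gt0.
  by have [_ [A [mA SA] <-] lt] := inf_adherent n0 infE; exists A.
have mh : measurable (\bigcap_n A n).
  by apply: bigcap_measurable => // k _; have [] := AP k.
exists (\bigcap_n A n); split => //.
  by move=> x Sx n _; have [_ + _] := AP n; apply.
move=> D mD Dh DS; apply/eqP; rewrite eq_le unit_measure_ge0 andbT.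
have mhD : measurable (\bigcap_n A n `\` D) by exact: measurableD.
(* As [D] misses [S], the envelope without [D] still contains [S] and competes for the infimum. *)
have : inf E <= nu (\bigcap_n A n `\` D).
  apply: ge_inf; first by case: infE.
  exists (\bigcap_n A n `\` D) => //; split => // x Sx; split.
    by move=> n _; have [_ + _] := AP n; apply.
  by move=> Dx; have : (D `&` S) x by []; rewrite DS.
have := unit_measure_split mh mD; rewrite (setIidr Dh) => hE.
suff : nu (\bigcap_n A n) <= inf E by lra.
apply/ler_addgt0Pr => e e0.
have [k _ /(_ _ (leqnn k))/= ke] := near_infty_natSinv_lt (PosNum e0).
have [mAk _ Ak] := AP k.
apply: (@le_trans _ _ (nu (A k))); last by rewrite ltW// (lt_trans Ak)// ltrD2l.
by apply: le_unit_measure => //; apply: bigcap_inf.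
Unshelve. all: by end_near.
Qed.

(* Equivalently, [T] has full outer measure in ]0, 1]; it need not be
   measurable. *)
Definition thick T := forall B, measurable B -> 0 < nu B ->
  exists t, [/\ 0 < t <= 1, B t & T t].

Lemma thickT : thick setT.
Proof.
move=> B mB B0; apply: contrapT => nB.
suff : nu B = 0 by move=> nuB; rewrite nuB ltxx in B0.
rewrite /nu (_ : B `&` I01 = set0) ?measure0//.
rewrite -subset0 => t [Bt]; rewrite /I01/= in_itv/= => t01.
by apply: nB; exists t.
Qed.

(** Give [x] the first label whose envelope contains it. A set [B] of positive measure splits into
    countably many pieces, one for each label, and a null set; a piece of positive measure lies in
    the envelope of some [T] [&] [E j], hence meets it. *)
Lemma thick_label T (E : nat -> set R) : thick T -> T `&` I01 `<=` \bigcup_j E j ->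
  exists g : R -> nat, (forall j, measurable [set x | g x = j]) /\
    thick [set t | T t /\ E (g t) t].
Proof.
move=> thT TE.
have /choice[h hP] : forall j, exists h, [/\ measurable h, T `&` E j `<=` h &
    forall D, measurable D -> D `<=` h -> D `&` (T `&` E j) = set0 -> nu D = 0].
  by move=> j; exact: measurable_hull.
have mh j : measurable (h j) by have [] := hP j.
(* [g x] is the first [j] such that [x] lies in the hull of [T `&` E j]. *)
pose g x := match pselect (exists j, `[< h j x >]) with
  | left p => ex_minn p | right _ => 0%N end.
have gh x j : h j x -> h (g x) x.
  move=> hx; rewrite /g; case: pselect => [p|[]].
    by case: ex_minnP => k /asboolP.
  by exists j; apply/asboolP.
have gmin x j : h j x -> (g x <= j)%N.
  move=> hx; rewrite /g; case: pselect => [p|[]]; last by exists j; apply/asboolP.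
  by case: ex_minnP => k _; apply; apply/asboolP.
have mg j : measurable [set x | g x = j].
  have mU : measurable (\bigcup_k h k) by exact: bigcup_measurable.
  have -> : [set x | g x = j] =
      (h j `\` \bigcup_(k in [set k | (k < j)%N]) h k) `|`
      (if j == 0%N then ~` \bigcup_k h k else set0).
    apply/seteqP; split => x /=.
      move=> gj; have [[k _ hk]|nhx] := pselect ((\bigcup_k h k) x).
        left; split; first by rewrite -gj; exact: gh hk.
        by case=> i /= ij /gmin; rewrite gj leqNgt ij.
      right; move: gj; rewrite /g; case: pselect => [p|_ <-//].
      by exfalso; apply: nhx; have [k /asboolP hk] := p; exists k.
    case=> [[hj nhk]|].
      have gj := gmin _ _ hj; apply/eqP; rewrite eqn_leq gj/= leqNgt.
      by apply/negP => lt; apply: nhk; exists (g x) => //; exact: gh hj.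
    case: eqP => // -> nh; rewrite /g; case: pselect => // p.
    by exfalso; apply: nh; have [k /asboolP hk] := p; exists k.
  apply: measurableU; last by case: ifP => // _; exact: measurableC.
  by apply: measurableD => //; exact: bigcup_measurable.
exists g; split => // B.
wlog BI : B / B `<=` I01 => [wl mB B0|mB B0].
  have [||t [t01 [Bt _] Tt]] := wl (B `&` I01) (@subIsetr _ _ _).
  - exact: measurableI.
  - by rewrite /nu -setIA setIid.
  - by exists t.
apply: contrapT => nt.
pose D j := B `&` [set x | g x = j] `&` h j.
have mD j : measurable (D j) by apply: measurableI => //; exact: measurableI.
pose N := B `\` \bigcup_j h j.
have mN : measurable N by apply: measurableD => //; exact: bigcup_measurable.
have BDN : B = \bigcup_j D j `|` N.
  apply/seteqP; split => x.
    move=> Bx; have [[k _ hk]|nhx] := pselect ((\bigcup_k h k) x); last by right.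
    by left; exists (g x) => //; split => //; exact: gh hk.
  by case=> [[j _ [[Bx _] _]]|[Bx _]].
(* Otherwise [N] would meet [T], but the sets [E j] cover [T] within the unit interval. *)
have N0 : nu N = 0.
  apply/eqP; rewrite eq_le unit_measure_ge0 andbT leNgt; apply/negP => nN.
  have [t [t01 [Bt nht] Tt]] := thT _ mN nN.
  have [|j _ Ejt] := TE t; first by split => //=; rewrite /I01/= in_itv.
  by apply: nht; exists j => //; have [_ + _] := hP j; apply.
have D0 j : nu (D j) = 0.
  have [_ _] := hP j; apply=> //; first by move=> x [].
  rewrite -subset0 => t [[[Bt gt] ht] [Tt Et]].
  apply: nt; exists t; split => //; last by split => //; rewrite gt.
  by have := BI _ Bt; rewrite /I01/= in_itv.
have mDD : measurable (\bigcup_j D j) by exact: bigcup_measurable.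
have : nu B = 0.
  rewrite BDN unit_measureU//.
    by rewrite N0 unit_measure_bigcup0// addr0.
  by rewrite -subset0 => x [[j _ [_ hj]] [_]]; apply; exists j.
by move=> nuB; rewrite nuB ltxx in B0.
Qed.

(** Lusin's theorem makes [g] continuous on a compact set of almost full measure. An integer-valued
    continuous function is locally constant, and compactness makes the radius uniform. *)
Lemma lusin_nat (g : R -> nat) (e : R) :
  (forall j, measurable [set x | g x = j]) -> 0 < e ->
  exists K (d : R), [/\ measurable K, 0 < d, nu (~` K) <= e &
    forall x y, K x -> K y -> `|x - y| < d -> g x = g y].
Proof.
move=> mg e0; pose f x : R := (g x)%:R.
have mf : measurable_fun I01 f.
  move=> _ B mB; apply: measurableI => //.
  have -> : f @^-1` B = \bigcup_(j in [set j | B j%:R]) [set x | g x = j].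
    apply/seteqP; split => x /=; first by move=> Bx; exists (g x).
    by move=> [j /= Bj gx]; rewrite /f gx.
  exact: bigcup_measurable.
have finI : (lebesgue_measure I01 < +oo)%E.
  by have := mu_fin (@measurableT _ R); rewrite setTI ge0_fin_numE.
have [K [cK KI Ke cf]] := measurable_almost_continuous mI01 finI e0 mf.
have mK : measurable K by exact: compact_measurable.
have nK : nu (~` K) <= e.
  rewrite /nu setIC -setDE -lee_fin fineK ?ltW//.
  by rewrite setDE setIC mu_fin//; exact: measurableC.
suff [d d0 Kd] : exists2 d, 0 < d &
    forall x y, K x -> K y -> `|x - y| < d -> g x = g y by exists K, d.
have /compact_near_coveringP ncK := cK.
pose P (d : R) x := forall y, K x -> K y -> `|x - y| < d -> g x = g y.
have := ncK R (0^'+) P _; case=> [x Kx|d /= d0 dP].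
  (* Integers at distance less than 1 are equal, so the tolerance 1 suffices. *)
  have : @nbhs_subspace _ K x [set y | `|f x - f y| < 1].
    by have /(_ x)/cvgrPdist_lt/(_ 1 ltr01) := cf.
  rewrite -nbhs_subspace_in// => /nbhs_ballP[r /= r0 xr].
  have gr y : K y -> `|x - y| < r -> g y = g x.
    move=> Ky xy; have := xr y xy Ky; rewrite /f/=.
    case: (ltngtP (g x) (g y)) => [lt|lt|->//].
      rewrite distrC -natrB ?(ltnW lt)// normr_nat.
      by rewrite -[X in _ < X]/(1%:R) ltr_nat ltnS leqn0 subn_eq0 leqNgt lt.
    rewrite -natrB ?(ltnW lt)// normr_nat.
    by rewrite -[X in _ < X]/(1%:R) ltr_nat ltnS leqn0 subn_eq0 leqNgt lt.
  exists (ball x (r / 2), [set d | 0 < d < r / 2]).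
    split => /=; first by apply: nbhsx_ballx; lra.
    by exists (r / 2) => /=; [lra|move=> z /=; rewrite sub0r normrN => zr z0; rewrite z0/=; rewrite gtr0_norm in zr].
  move=> [x' d] /= [xx' /andP[d0 dr]] y Kx' Ky x'y.
  rewrite -ball_normE/= in xx'.
  rewrite (gr x')//; last by lra.
  rewrite (gr y)//; have := ler_distD x' x y; lra.
exists (d / 2); first by lra.
have Pd : forall x, K x -> P (d / 2) x.
  apply: dP => /=; last by lra.
  by rewrite sub0r normrN gtr0_norm; lra.
by move=> x y Kx Ky xy; exact: (Pd x Kx y).
Qed.

End unit_measure.

(** * Hausdorff closeness and Minkowski operations *)

Section hausdorff_closeness.
Variables (R : realType) (X : normedModType R).
Implicit Types (A B C D : set X) (e : R).

(** A point of [B] must realize the bound, which says more than that the distance to [B] is at most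
    [e]; hence the strict inequality assumed in [hausdorff_dist_lt]. *)
Definition within_dist e A B := forall a, A a -> exists2 b, B b & `|a - b| <= e.
Definition hausdorff_le e A B := within_dist e A B /\ within_dist e B A.

Lemma within_dist_trans B e1 e2 A C :
  within_dist e1 A B -> within_dist e2 B C -> within_dist (e1 + e2) A C.
Proof.
move=> AB BC a /AB[b /BC[c Cc bc] ab]; exists c => //.
by rewrite (le_trans (ler_distD b _ _))// lerD.
Qed.

Lemma hausdorff_le_sym e A B : hausdorff_le e A B -> hausdorff_le e B A.
Proof. by case. Qed.

Lemma hausdorff_le_trans B e1 e2 A C :
  hausdorff_le e1 A B -> hausdorff_le e2 B C -> hausdorff_le (e1 + e2) A C.
Proof.
move=> [AB BA] [BC CB]; split; first exact: within_dist_trans BC.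
by rewrite addrC; exact: within_dist_trans BA.
Qed.

Lemma hausdorff_le_mono e1 e2 A B :
  e1 <= e2 -> hausdorff_le e1 A B -> hausdorff_le e2 A B.
Proof.
by move=> e12 [AB BA]; split=> [a /AB|b /BA] [c Cc le]; exists c => //;
  exact: le_trans e12.
Qed.

Lemma hausdorff_le_refl e A : 0 <= e -> hausdorff_le e A A.
Proof. by move=> e0; split=> a Aa; exists a => //; rewrite subrr normr0. Qed.

Lemma hausdorff_leD e1 e2 A B C D : hausdorff_le e1 A B -> hausdorff_le e2 C D ->
  hausdorff_le (e1 + e2) (minkowski_add A C) (minkowski_add B D).
Proof.
move=> [AB BA] [CD DC]; split=> _ [a aA [c cC <-]].
- have [b Bb ab] := AB _ aA; have [d Dd cd] := CD _ cC; exists (b + d).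
    by exists b => //; exists d.
  by rewrite opprD addrACA (le_trans (ler_normD _ _))// lerD.
- have [b Bb ab] := BA _ aA; have [d Dd cd] := DC _ cC; exists (b + d).
    by exists b => //; exists d.
  by rewrite opprD addrACA (le_trans (ler_normD _ _))// lerD.
Qed.

Lemma hausdorff_leZ t e A B : 0 <= t -> hausdorff_le e A B ->
  hausdorff_le (t * e) (minkowski_scale t A) (minkowski_scale t B).
Proof.
move=> t0 [AB BA]; split=> _ [a aA <-].
- have [b Bb ab] := AB _ aA; exists (t *: b); first by exists b.
  by rewrite -scalerBr normrZ ger0_norm// ler_wpM2l.
- have [b Bb ab] := BA _ aA; exists (t *: b); first by exists b.
  by rewrite -scalerBr normrZ ger0_norm// ler_wpM2l.
Qed.

Lemma hausdorff_le_bounded (M : R) A B : A !=set0 -> B !=set0 ->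
  (forall x, A x -> `|x| <= M) -> (forall x, B x -> `|x| <= M) ->
  hausdorff_le (2 * M) A B.
Proof.
move=> [a0 Aa0] [b0 Bb0] AM BM; split=> [a Aa|b Bb].
  exists b0 => //; rewrite (le_trans (ler_normB _ _))//.
  by have := AM _ Aa; have := BM _ Bb0; lra.
exists a0 => //; rewrite (le_trans (ler_normB _ _))//.
by have := AM _ Aa0; have := BM _ Bb; lra.
Qed.

Let edist_inf_le e e' A b a : e < e' -> 0 < e' -> A a -> `|b - a| <= e ->
  (edist_inf A b <= e'%:E)%E.
Proof.
move=> ee e0 Aa ba; apply: (@le_trans _ _ (edist (b, a))).
  by apply: ereal_inf_lbound; exists a.
by apply: edist_fin => //=; rewrite -ball_normE/=; exact: le_lt_trans ee.
Qed.

Lemma hausdorff_dist_le e e' A B : 0 < e' -> e < e' -> hausdorff_le e A B ->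
  (hausdorff_dist A B <= e'%:E)%E.
Proof.
move=> e0 ee [AB BA]; rewrite /hausdorff_dist ge_max; apply/andP; split.
  apply: ge_ereal_sup => _ [a Aa <-]; have [b Bb ab] := AB a Aa.
  exact: edist_inf_le ab.
apply: ge_ereal_sup => _ [a Aa <-]; have [b Bb ab] := BA a Aa.
exact: edist_inf_le ab.
Qed.

Lemma hausdorff_dist_ge0 A B : A !=set0 -> (0 <= hausdorff_dist A B)%E.
Proof.
move=> [a Aa]; rewrite /hausdorff_dist le_max; apply/orP; left.
apply: le_trans (edist_inf_ge0 B a) _.
by apply: ereal_sup_ubound; exists a.
Qed.

Let edist_inf_lt e A b : (edist_inf A b < e%:E)%E -> exists2 a, A a & `|b - a| <= e.
Proof.
case/ereal_inf_lt => _ [a Aa <-] /edist_lt_ball; rewrite -ball_normE/= => lt.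
by exists a => //; exact: ltW.
Qed.

Lemma hausdorff_dist_lt e A B : (hausdorff_dist A B < e%:E)%E -> hausdorff_le e A B.
Proof.
rewrite /hausdorff_dist gt_max => /andP[AB BA].
split=> [a Aa|b Bb]; apply: edist_inf_lt.
  by apply: le_lt_trans AB; apply: ereal_sup_ubound; exists a.
by apply: le_lt_trans BA; apply: ereal_sup_ubound; exists b.
Qed.

End hausdorff_closeness.

Section minkowski.
Variables (R : realType) (X : normedModType R).
Implicit Types (A B C D : set X) (e : R).

Lemma minkowski_add_neq0 A B : A !=set0 -> B !=set0 -> minkowski_add A B !=set0.
Proof. by move=> [a Aa] [b Bb]; exists (a + b), a => //; exists b. Qed.

Lemma minkowski_scale_neq0 t A : A !=set0 -> minkowski_scale t A !=set0.
Proof. by move=> [a Aa]; exists (t *: a), a. Qed.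

Lemma minkowski_scale0 A : A !=set0 -> minkowski_scale 0 A = [set 0].
Proof.
move=> [a Aa]; apply/seteqP; split=> [_ [b _ <-]|_ ->]; rewrite ?scale0r//.
by exists a => //; rewrite scale0r.
Qed.

Lemma compact_minkowski_add A B : compact A -> compact B ->
  compact (minkowski_add A B).
Proof.
move=> cA cB.
have -> : minkowski_add A B = (fun p : X * X => p.1 + p.2) @` (A `*` B).
  apply/seteqP; split=> [_ [a Aa [b Bb <-]]|_ [[a b] [/= Aa Bb] <-]].
    by exists (a, b).
  by exists a => //; exists b.
apply: continuous_compact; last exact: compact_setX.
by apply: continuous_subspaceT; exact: add_continuous.
Qed.

Lemma compact_minkowski_scale t A : compact A -> compact (minkowski_scale t A).
Proof.
move=> cA; apply: continuous_compact => //.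
by apply: continuous_subspaceT; exact: scaler_continuous.
Qed.

End minkowski.

(** * Compactness and limits for the Hausdorff distance in a complete space *)

Section completeness.
Variables (R : realType) (X : completeNormedModType R).
Implicit Types (A B : set X).

(** Approximation by compact sets makes [A] totally bounded, so every ultrafilter on [A] is Cauchy
    and converges by completeness. *)
Lemma compact_hausdorff_approx A : closed A ->
  (forall e, 0 < e -> exists2 B, compact B & within_dist e A B) -> compact A.
Proof.
move=> clA AB; rewrite compact_ultra => F FU FA.
have cF : cauchy F.
  apply: cauchy_exP => e e0.
  have [|B cB ABe] := AB (e / 2); first by lra.
  move: cB; rewrite compact_cover => /(_ X B (fun x => ball x (e / 2))).
  case=> [x _|x Bx|D DB BD]; first exact: ball_open.
    by exists x => //; apply: ballxx; lra.
  (* Finitely many balls of radius [e / 2] cover [B], so the balls of radius [e] with the same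
     centers cover [A]. If the ultrafilter contained none of these, it would contain all their
     complements, which have no common point in [A]. *)
  apply: contrapT => nF.
  have : F (\bigcap_(i in [set` D]) ~` ball i e).
    apply: filter_bigI => i _; have [Fi|//] := in_ultra_setVsetC (ball i e) FU.
    by exfalso; apply: nF; exists i.
  move=> /(filterI FA)/filter_ex[a [Aa aD]].
  have [b Bb ab] := ABe _ Aa; have [c cD] := BD _ Bb.
  move=> bc; apply: (aD c cD); move: bc; rewrite -ball_normE/= => bc.
  by have := ler_distD b c a; rewrite (distrC b a); lra.
have /cauchy_cvgP/cvg_ex[p Fp] := cF.
exists p; split => //; apply: clA => U /Fp FU'.
by have /filter_ex : F (A `&` U) by exact: filterI.
Qed.

Lemma cvg_dyadic (x : nat -> X) (c : R) : 0 <= c ->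
  (forall k, `|x k - x k.+1| <= c * 2^-1 ^+ k) ->
  exists y, forall k, `|x k - y| <= 2 * c * 2^-1 ^+ k.
Proof.
move=> c0 xc.
(* The tail of the geometric series is kept in the bound for the induction to close. *)
have xcd k d : `|x k - x (k + d)%N| <= 2 * c * 2^-1 ^+ k - 2 * c * 2^-1 ^+ (k + d).
  elim: d => [|d IH]; first by rewrite addn0 !subrr normr0.
  rewrite addnS (le_trans (ler_distD (x (k + d)%N) _ _))//.
  by have := xc (k + d)%N; rewrite exprS; lra.
have pow_ge0 k : 0 <= 2^-1 ^+ k :> R by rewrite exprn_ge0// invr_ge0.
have xck k d : `|x k - x (k + d)%N| <= 2 * c * 2^-1 ^+ k.
  have := xcd k d; have : 0 <= 2 * c * 2^-1 ^+ (k + d).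
    by rewrite mulr_ge0// mulr_ge0.
  lra.
have half0 : 2 * c * 2^-1 ^+ n @[n --> \oo] --> (0 : R).
  have h1 : `|2^-1| < 1 :> R by rewrite ger0_norm ?invr_ge0// invf_lt1// ltr1n.
  rewrite -[X in _ --> X](mulr0 (2 * c)); apply: cvgM; first exact: cvg_cst.
  exact: cvg_expr.
have cx : cauchy (x @ \oo).
  apply: cauchy_exP => e e0.
  have /cvgrPdist_lt/(_ e e0)[k _ /(_ k (leqnn k))/= ke] := half0.
  exists (x k), k => // n /= kn; rewrite -ball_normE/= -(subnKC kn).
  apply: le_lt_trans (xck _ _) _.
  by apply: le_lt_trans ke; rewrite sub0r normrN ler_norm.
have /cauchy_cvgP/cvg_ex[y xy] := cx.
exists y => k; apply/ler_addgt0Pr => e e0.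
have /cvgrPdist_lt/(_ e e0)[m _ ym] := xy.
have := ym (k + m)%N (leq_addl _ _); rewrite /= distrC => lt.
by have := ler_distD (x (k + m)%N) (x k) y; have := xck k m; lra.
Qed.

(** From a point of [U k], pass step by step to nearby points of the following sets; this chain
    converges to a point of the limit set. The summand [2^-1 ^+ k] pays for taking the closure. *)
Lemma hausdorff_limit (U : nat -> set X) (c : R) : 0 <= c ->
  (forall k, U k !=set0) ->
  (forall k l, (k <= l)%N -> hausdorff_le (c * 2^-1 ^+ k) (U k) (U l)) ->
  exists A, [/\ A !=set0, closed A &
    forall k, hausdorff_le (3 * c * 2^-1 ^+ k + 2^-1 ^+ k) (U k) A].
Proof.
move=> c0 U0 UU.
have pow_ge0 k : 0 <= 2^-1 ^+ k :> R by rewrite exprn_ge0// invr_ge0.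
(* The constant is 3 = 2 + 1: a chain started in [U k] costs 2, and going back from [U k] to an
   earlier [U l] costs 1. *)
pose A0 : set X := [set y | forall k, exists2 u, U k u & `|u - y| <= 3 * c * 2^-1 ^+ k].
have UA k : within_dist (2 * c * 2^-1 ^+ k) (U k) A0.
  move=> u Uu.
  have /choice[f fP] : forall p : nat * X, exists v,
      U p.1 p.2 -> U p.1.+1 v /\ `|p.2 - v| <= c * 2^-1 ^+ p.1.
    move=> [l a]; have [Ua|] := pselect (U l a); last by exists 0.
    by have [/(_ _ Ua)[b Ub ab] _] := UU l l.+1 (leqnSn l); exists b.
  pose x := fix x n := if n is m.+1 then f ((k + m)%N, x m) else u.
  have xU n : U (k + n)%N (x n).
    elim: n => [|n IH]; first by rewrite addn0.
    by rewrite addnS; have [] := fP ((k + n)%N, x n) IH.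
  have [|n|y xy] := @cvg_dyadic x (c * 2^-1 ^+ k).
  - by rewrite mulr_ge0.
  - by have [_] := fP ((k + n)%N, x n) (xU n); rewrite exprD mulrA.
  have {}xy n : `|x n - y| <= 2 * c * 2^-1 ^+ (k + n).
    by have := xy n; rewrite exprD !mulrA.
  exists y; last by have := xy 0%N; rewrite addn0.
  move=> l; have [kl|lk] := leqP k l.
    exists (x (l - k)%N); first by have := xU (l - k)%N; rewrite subnKC.
    have := xy (l - k)%N; rewrite subnKC// => le; apply: le_trans le _.
    by rewrite ler_wpM2r// ler_wpM2r// ler_nat.
  have [_ /(_ _ Uu)[v Uv uv]] := UU l k (ltnW lk).
  exists v => //; have := ler_distD u v y; rewrite (distrC v u).
  have := xy 0%N; rewrite addn0 /=.
  have : c * 2^-1 ^+ k <= c * 2^-1 ^+ l.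
    by rewrite ler_wpM2l// ler_wiXn2l ?invr_ge0// ?invf_le1 ?ler1n// ltnW.
  lra.
have A0ne : A0 !=set0.
  by have [u Uu] := U0 0%N; have [y Ay _] := UA 0%N u Uu; exists y.
exists (closure A0); split.
- by have [y Ay] := A0ne; exists y; exact: subset_closure.
- exact: closed_closure.
move=> k; have pk : 0 < 2^-1 ^+ k :> R by rewrite exprn_gt0// invr_gt0.
split=> [u Uu|y Ay].
  have [y Ay uy] := UA k u Uu; exists y; first exact: subset_closure.
  have : 0 <= c * 2^-1 ^+ k by rewrite mulr_ge0.
  lra.
have [z [Az]] := Ay _ (nbhsx_ballx y _ pk).
rewrite -ball_normE/= => yz; have [u Uu uz] := Az k; exists u => //.
by have := ler_distD z y u; rewrite (distrC z u); lra.
Qed.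

End completeness.

(** * Convex hulls of finite sets *)

Section convexity.
Variables (R : realType) (X : normedModType R).
Implicit Types (A C D : set X) (v : seq X).

Definition convex C := forall a b x y, 0 <= a -> 0 <= b -> a + b = 1 ->
  C x -> C y -> C (a *: x + b *: y).

(** The weights need not add up to 1: [c] is the barycenter, and any point of [C] will do if the
    total weight vanishes. *)
Lemma convex_sum C (I : Type) (r : seq I) (P : pred I) (w : I -> R) (y : I -> X) :
  convex C -> C !=set0 -> (forall i, 0 <= w i) -> (forall i, C (y i)) ->
  exists2 c, C c &
    \sum_(i <- r | P i) w i *: y i = (\sum_(i <- r | P i) w i) *: c.
Proof.
move=> cC [c0 Cc0] w0 Cy.
suff [] : 0 <= \sum_(i <- r | P i) w i /\ exists2 c, C c &
    \sum_(i <- r | P i) w i *: y i = (\sum_(i <- r | P i) w i) *: c by [].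
elim/big_rec2: _ => [|i x s _ [s0 [c Cc ->]]].
  by split => //; exists c0 => //; rewrite scale0r.
split; first by rewrite addr_ge0.
have [s0'|s0'] := eqVneq (w i + s) 0.
  have [wi ss] : w i = 0 /\ s = 0 by have := w0 i; split; lra.
  by exists c0 => //; rewrite wi ss addr0 !scale0r addr0.
exists ((w i / (w i + s)) *: y i + (s / (w i + s)) *: c).
  apply: cC => //; try by rewrite divr_ge0// addr_ge0.
  by rewrite -mulrDl divff.
by rewrite scalerDr !scalerA !(mulrC (w i + s)) !mulfVK.
Qed.

Definition hull v : set X := [set x | exists a : nat -> R,
  [/\ forall i, 0 <= a i, \sum_(i < size v) a i = 1 &
      x = \sum_(i < size v) a i *: v`_i]].

Lemma hull_convex v : convex (hull v).
Proof.
move=> a b _ _ a0 b0 ab [p [p0 p1 ->]] [q [q0 q1 ->]].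
exists (fun i => a * p i + b * q i); split.
- by move=> i; rewrite addr_ge0// mulr_ge0.
- by rewrite big_split/= -!mulr_sumr p1 q1 !mulr1.
- by rewrite !scaler_sumr -big_split/=; apply: eq_bigr => i _;
    rewrite scalerDl !scalerA.
Qed.

Lemma sub_hull v x : x \in v -> hull v x.
Proof.
move=> xv; pose k := index x v; have kv : (k < size v)%N by rewrite index_mem.
exists (fun i => (i == k)%:R); split.
- by move=> i; rewrite ler0n.
- rewrite (bigD1 (Ordinal kv))//= eqxx big1 ?addr0// => i /negP ik.
  by case: eqP => // ek; exfalso; apply: ik; apply/eqP/val_inj.
- rewrite (bigD1 (Ordinal kv))//= eqxx scale1r nth_index// big1 ?addr0// => i /negP ik.
  by case: eqP => [ek|]; [exfalso; apply: ik; apply/eqP/val_inj|rewrite scale0r].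
Qed.

Lemma hull_neq0 v : v != [::] -> hull v !=set0.
Proof. by case: v => // x v _; exists x; apply: sub_hull; rewrite mem_head. Qed.

Lemma norm_hull (M : R) v x : (forall y, y \in v -> `|y| <= M) -> hull v x -> `|x| <= M.
Proof.
move=> vM [a [a0 a1 ->]]; rewrite (le_trans (ler_norm_sum _ _ _))//.
rewrite -[leRHS]mul1r -a1 mulr_suml ler_sum// => i _.
by rewrite normrZ ger0_norm// ler_wpM2l// vM// mem_nth.
Qed.

(** Move every vertex to a nearby one and keep the barycentric coefficients. *)
Lemma within_dist_hull e v v' : v' != [::] ->
  within_dist e [set` v] [set` v'] -> within_dist e (hull v) (hull v').
Proof.
move=> v'0 vv' _ [a [a0 a1 ->]].
have /choice[f fP] : forall i : nat, exists y, hull v' y /\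
    ((i < size v)%N -> `|v`_i - y| <= e).
  move=> i; have [iv|iv] := ltnP i (size v).
    by have [y /= /sub_hull v'y yi] := vv' _ (mem_nth 0 iv); exists y.
  by have [y Hy] := hull_neq0 v'0; exists y.
have [c Hc cE] := @convex_sum _ _ (index_enum 'I_(size v)) predT
  (fun i => a i) (fun i => f i) (@hull_convex v') (hull_neq0 v'0)
  (fun i => a0 i) (fun i => (fP i).1).
exists c => //; rewrite a1 scale1r in cE; rewrite -cE -sumrB.
rewrite (le_trans (ler_norm_sum _ _ _))// -[leRHS]mul1r -a1 mulr_suml ler_sum// => i _.
rewrite -scalerBr normrZ ger0_norm// ler_wpM2l//.
by have [_] := fP i; apply.
Qed.

Lemma hausdorff_le_hull e v v' : v != [::] -> v' != [::] ->
  hausdorff_le e [set` v] [set` v'] -> hausdorff_le e (hull v) (hull v').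
Proof. by move=> v0 v'0 [h1 h2]; split; exact: within_dist_hull. Qed.

Lemma mem_minkowski_sum (n : nat) (A : nat -> set X) x :
  (\big[@minkowski_add X/[set 0]]_(i < n) A i) x <->
  exists2 f : nat -> X, (forall i, (i < n)%N -> A i (f i)) & x = \sum_(i < n) f i.
Proof.
elim: n A x => [|n IH] A x.
  rewrite !big_ord0; split=> [->|[f _]]; last by rewrite big_ord0.
  by exists (fun=> 0) => //; rewrite big_ord0.
rewrite big_ord_recl; split.
  move=> [a Aa [b /(IH (fun i => A i.+1))[f fA ->] <-]].
  exists (fun i => if i is k.+1 then f k else a); first by case.
  by rewrite big_ord_recl.
move=> [f fA ->]; rewrite big_ord_recl; exists (f 0%N); first exact: fA.
exists (\sum_(i < n) f i.+1) => //; apply/(IH (fun i => A i.+1)).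
by exists (fun i => f i.+1) => // i; exact: fA i.+1.
Qed.

(** Cut the contribution of each [C i] into portions of weight [w i j] and move each portion to a
    nearby point of [D j]. The portions that arrive in the same [D j] merge into one point by
    convexity. *)
Let minkowski_coupling1 (m n : nat) (w e : nat -> nat -> R) (C D : nat -> set X) :
  (forall i j, 0 <= w i j) ->
  (forall j, convex (D j)) -> (forall j, D j !=set0) ->
  (forall i j, (i < m)%N -> (j < n)%N -> within_dist (e i j) (C i) (D j)) ->
  within_dist (\sum_(i < m) \sum_(j < n) w i j * e i j)
    (\big[@minkowski_add X/[set 0]]_(i < m) minkowski_scale (\sum_(j < n) w i j) (C i))
    (\big[@minkowski_add X/[set 0]]_(j < n) minkowski_scale (\sum_(i < m) w i j) (D j)).
Proof.
move=> w0 cD D0 CDe x /(mem_minkowski_sum m (fun i => minkowski_scale (\sum_(j < n) w i j) (C i))).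
move=> [f0 f0C ->].
have /choice[f fC] : forall i : nat, exists y, (i < m)%N ->
    C i y /\ (\sum_(j < n) w i j) *: y = f0 i.
  move=> i; have [im|] := ltnP i m; last by exists 0.
  by have [y Cy yE] := f0C i im; exists y.
have /choice[d dP] : forall ij : nat * nat, exists y, D ij.2 y /\
    ((ij.1 < m)%N -> (ij.2 < n)%N -> `|f ij.1 - y| <= e ij.1 ij.2).
  move=> [i j] /=; have [[im jn]|nij] := pselect ((i < m)%N /\ (j < n)%N).
    by have [y Dy le] := CDe i j im jn _ (fC i im).1; exists y.
  by have [y Dy] := D0 j; exists y; split => // im jn; exfalso; apply: nij.
have /choice[g gP] : forall j : nat, exists c, D j c /\
    \sum_(i < m) w i j *: d (val i, j) = (\sum_(i < m) w i j) *: c.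
  move=> j; have [c Dc cE] := @convex_sum _ _ (index_enum 'I_m) predT
    (fun i => w i j) (fun i => d (val i, j)) (cD j) (D0 j)
    (fun i => w0 i j) (fun i => (dP (val i, j)).1).
  by exists c.
exists (\sum_(j < n) (\sum_(i < m) w i j) *: g j).
  apply/(mem_minkowski_sum n (fun j => minkowski_scale (\sum_(i < m) w i j) (D j))).
  by exists (fun j => (\sum_(i < m) w i j) *: g j) => // j _; exists (g j) => //; have [] := gP j.
have -> : \sum_(i < m) f0 i = \sum_(i < m) \sum_(j < n) w i j *: f i.
  by apply: eq_bigr => i _; rewrite -scaler_suml; have [_ ->] := fC i (ltn_ord i).
have -> : \sum_(j < n) (\sum_(i < m) w i j) *: g j =
    \sum_(i < m) \sum_(j < n) w i j *: d (val i, val j).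
  rewrite exchange_big/=; apply: eq_bigr => j _.
  by have [_ <-] := gP j.
rewrite -sumrB (le_trans (ler_norm_sum _ _ _))// ler_sum// => i _.
rewrite -sumrB (le_trans (ler_norm_sum _ _ _))// ler_sum// => j _.
rewrite -scalerBr normrZ ger0_norm// ler_wpM2l//.
by have [_] := dP (val i, val j); apply => /=.
Qed.

(* A coupling [w] of two weight vectors, as in optimal transport. *)
Lemma minkowski_coupling (m n : nat) (w e : nat -> nat -> R) (C D : nat -> set X) :
  (forall i j, 0 <= w i j) ->
  (forall i, convex (C i)) -> (forall i, C i !=set0) ->
  (forall j, convex (D j)) -> (forall j, D j !=set0) ->
  (forall i j, (i < m)%N -> (j < n)%N -> hausdorff_le (e i j) (C i) (D j)) ->
  hausdorff_le (\sum_(i < m) \sum_(j < n) w i j * e i j)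
    (\big[@minkowski_add X/[set 0]]_(i < m) minkowski_scale (\sum_(j < n) w i j) (C i))
    (\big[@minkowski_add X/[set 0]]_(j < n) minkowski_scale (\sum_(i < m) w i j) (D j)).
Proof.
move=> w0 cC C0 cD D0 CD; split.
  by apply: minkowski_coupling1 => // i j im jn; have [] := CD i j im jn.
rewrite exchange_big; apply: (@minkowski_coupling1 n m (fun j i => w i j) (fun j i => e i j)) => //.
by move=> i j im jn; have [] := CD j i jn im.
Qed.

(** The error does not depend on [n]; this is why averaging many copies of a finite set convexifies
    it. Rounding the coefficients down and completing the list cost at most [(size v)%:R * M]
    each. *)
Lemma hull_rounding (M : R) v n x : (forall y, y \in v -> `|y| <= M) ->
  v != [::] -> hull v x ->
  exists l : seq X, [/\ size l = n, {subset l <= v} &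
    `|\sum_(y <- l) y - n%:R *: x| <= 2 * (size v)%:R * M].
Proof.
move=> vM v0 [a [a0 a1 ->]].
have M0 : 0 <= M.
  by case: v v0 vM {a1} => // y v _ /(_ y (mem_head _ _)); exact: le_trans.
pose c i := Num.truncn (n%:R * a i).
have na0 i : 0 <= n%:R * a i by rewrite mulr_ge0.
have cle i : (c i)%:R <= n%:R * a i by have /andP[] := truncn_itv (na0 i).
have ltc i : n%:R * a i - (c i)%:R <= 1.
  by have /andP[_ /ltW] := truncn_itv (na0 i); rewrite -natr1 lerBlDl addrC.
pose L := flatten [seq nseq (c i) v`_i | i <- iota 0 (size v)].
have iE : iota 0 (size v) = index_iota 0 (size v) by rewrite /index_iota subn0.
have LS : \sum_(y <- L) y = \sum_(i < size v) (c i)%:R *: v`_i.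
  rewrite /L big_flatten/= big_map iE big_mkord; apply: eq_bigr => i _.
  by rewrite big_nseq iter_addr addr0 scaler_nat.
have Lsz : (size L)%:R = \sum_(i < size v) (c i)%:R :> R.
  rewrite /L size_flatten /shape -map_comp sumnE big_map iE.
  rewrite big_mkord natr_sum.
  by apply: eq_bigr => i _ /=; rewrite size_nseq.
have nE : n%:R = \sum_(i < size v) n%:R * a i by rewrite -mulr_sumr a1 mulr1.
have Ln : (size L <= n)%N.
  by rewrite -(ler_nat R) Lsz nE ler_sum.
have nL : (n - size L)%:R <= (size v)%:R :> R.
  have -> : (size v)%:R = \sum_(i < size v) (1 : R) by rewrite sumr_const card_ord.
  rewrite natrB// Lsz nE -sumrB ler_sum// => i _.
(* The integer parts [c i] of [n * a i] leave less than [size v] points of the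
   list to be chosen arbitrarily. *)
exists (L ++ nseq (n - size L) v`_0); split.
- by rewrite size_cat size_nseq subnKC.
- move=> y; rewrite mem_cat => /orP[/flatten_mapP[i]|].
    by rewrite mem_iota add0n => /andP[_ iv] /nseqP[-> _]; rewrite mem_nth.
  by move=> /nseqP[-> _]; rewrite mem_nth// lt0n size_eq0.
rewrite big_cat big_nseq iter_addr addr0 LS scaler_sumr addrAC -sumrB.
rewrite (le_trans (ler_normD _ _))//.
have -> : 2 * (size v)%:R * M = (size v)%:R * M + (size v)%:R * M by lra.
apply: lerD.
  rewrite (le_trans (ler_norm_sum _ _ _))//.
  have -> : (size v)%:R * M = \sum_(i < size v) M.
    by rewrite sumr_const card_ord mulr_natl.
  rewrite ler_sum// => i _.
  rewrite scalerA -scalerBl normrZ distrC ger0_norm ?subr_ge0//.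
  by rewrite -[leRHS]mul1r ler_pM// ?subr_ge0// vM// mem_nth.
rewrite normrMn -[leLHS]mulr_natl ler_pM// vM// mem_nth//.
by rewrite lt0n size_eq0.
Qed.

Lemma hull_scale_sum v (l : seq X) : v != [::] -> {subset l <= v} ->
  exists2 x, hull v x & \sum_(y <- l) y = (size l)%:R *: x.
Proof.
move=> v0 lv; have [z Hz] := hull_neq0 v0.
have [|i|c Hc cE] := @convex_sum _ _ (index_enum 'I_(size l)) predT
  (fun=> 1) (fun i => l`_i) (@hull_convex v) (hull_neq0 v0).
- by [].
- by apply/sub_hull/lv/mem_nth.
exists c => //; rewrite sumr_const card_ord in cE; rewrite -cE.
by rewrite (big_nth 0) big_mkord; apply: eq_bigr => i _; rewrite scale1r.
Qed.

End convexity.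

(** * Finite sets dense among the compact sets, and measurable labels for [F] *)

Lemma separable_finite_net (R : realType) (X : normedModType R) (M : R) :
  separable X -> 0 <= M -> exists v : nat -> seq X,
  [/\ forall j, v j != [::], forall j y, y \in v j -> `|y| <= M + 1 &
    forall (A : set X) e, compact A -> A !=set0 -> (forall a, A a -> `|a| <= M) ->
      0 < e -> exists j, hausdorff_le e A [set` v j]].
Proof.
move=> [D /countable_injP[f finj] dD] M0.
(* A dense sequence in which points of norm above [M + 1] are replaced by 0, so that all the finite
   sets share one bound. *)
pose d n : X := let x := xget 0 [set x | D x /\ f x = n] in
  if `|x| <= M + 1 then x else 0.
have dM n : `|d n| <= M + 1.
  by rewrite /d; case: ifP => // _; rewrite normr0 addr_ge0.
have dd a e : 0 < e -> `|a| <= M -> exists n, `|a - d n| < e.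
  (* A radius of at most 1 keeps the approximating point below the norm [M + 1]. *)
  move=> e0 aM; pose r := Num.min e 1.
  have r0 : 0 < r by rewrite lt_min e0 ltr01.
  have [||x []] := dD (ball a r).
  - by exists a; exact: ballxx.
  - exact: ball_open.
  rewrite -ball_normE/= => ax Dx; exists (f x).
  have xE : xget 0 [set y | D y /\ f y = f x] = x.
    case: xgetP => [y -> [Dy fy]|/(_ x)/= nx]; last by exfalso; apply: nx.
    by apply: finj; [exact: mem_set|exact: mem_set|].
  rewrite /d xE; rewrite lt_min in ax; have /andP[axe ax1] := ax.
  rewrite ifT//; have := ler_distD a x 0; rewrite !subr0 (distrC x).
  lra.
(* The index codes a head and a tail, so that the list is never empty; an index that codes nothing
   gets [[:: 0]]. *)
pose v j : seq X :=
  if @choice.unpickle (nat * seq nat)%type j is Some p then map d (p.1 :: p.2) else [:: 0].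
exists v; split.
- by move=> j; rewrite /v; case: choice.unpickle => // -[].
- move=> j y; rewrite /v; case: choice.unpickle => [p|].
    by move=> /mapP[n _ ->].
  by rewrite inE => /eqP ->; rewrite normr0 addr_ge0.
move=> A e cA [a0 Aa0] AM e0.
move: cA; rewrite compact_cover.
move=> /(_ nat [set n | exists2 a, A a & `|a - d n| < e] (fun n => ball (d n) e)).
case=> [n _|a Aa|D' D'P AD']; first exact: ball_open.
  have [n an] := dd a e e0 (AM _ Aa).
  by exists n; [exists a|rewrite -ball_normE/= distrC].
have [n0 n0D' _] := AD' _ Aa0.
exists (@choice.pickle (nat * seq nat)%type (n0, D' : seq nat)); rewrite /v choice.pickleK/=; split=> [a Aa|x /=].
  have [n /= nD' ] := AD' _ Aa; rewrite -ball_normE/= => an.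
  exists (d n); last by rewrite distrC ltW.
  by rewrite inE; apply/orP; right; apply/mapP; exists n.
have key n : n \in D' -> exists2 b, A b & `|d n - b| <= e.
  by move=> /D'P/set_mem[b Ab bn]; exists b => //; rewrite distrC ltW.
by rewrite inE => /orP[/eqP ->|/mapP[n nD' ->]]; exact: key.
Qed.

(** Apply [thick_label] repeatedly, each time inside the thick set where all the previous labels are
    correct. These sets decrease, so a single [t] serves two levels at once. *)
Lemma measurable_approximation (R : realType) (X : normedModType R)
  (F : R -> set X) (v : nat -> seq X) :
  (forall t e, 0 < t <= 1 -> 0 < e -> exists j, hausdorff_le e (F t) [set` v j]) ->
  exists g : nat -> R -> nat, (forall m j, measurable [set x | g m x = j]) /\
    forall m l B, measurable B -> 0 < unit_measure B -> exists t,
      [/\ 0 < t <= 1, B t, hausdorff_le (2^-1 ^+ m) (F t) [set` v (g m t)] &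
        hausdorff_le (2^-1 ^+ l) (F t) [set` v (g l t)]].
Proof.
move=> Fv; pose E m j := [set t | hausdorff_le (2^-1 ^+ m) (F t) [set` v j]].
have /choice[step stepP] : forall mT : nat * set R, exists g : R -> nat,
    thick mT.2 -> (forall j, measurable [set x | g x = j]) /\
      thick [set t | mT.2 t /\ E mT.1 (g t) t].
  move=> [m T]; have [thT|] := pselect (thick T); last by exists (fun=> 0%N).
  have [|g gP] := @thick_label _ T (E m) thT; last by exists g.
  move=> t [_ /=]; rewrite in_itv/= => t01.
  have [|j] := Fv t (2^-1 ^+ m) t01; first by rewrite exprn_gt0// invr_gt0.
  by exists j.
pose T := fix T m : set R := if m is k.+1 then
  [set t | T k t /\ E k (step (k, T k) t) t] else setT.
have thT m : thick (T m).
  by elim: m => [|m IH]; [exact: thickT|have [] := stepP (m, T m) IH].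
pose g m := step (m, T m).
have Tsub m k : T (m + k)%N `<=` T m.
  elim: k => [|k IH]; first by rewrite addn0.
  by rewrite addnS => t [/IH].
exists g; split; first by move=> m j; have [+ _] := stepP (m, T m) (thT m); apply.
(* The label [g m] is correct on [T m.+1], not on [T m]; the index [m.+1 + l.+1] lies beyond both
   [m.+1] and [l.+1]. *)
move=> m l B mB B0; have [t [t01 Bt Tt]] := thT (m.+1 + l.+1)%N B mB B0.
exists t; split => //.
  by have [] := Tsub _ _ _ Tt.
by rewrite addnC in Tt; have [] := Tsub _ _ _ Tt.
Qed.

(** * Tagged partitions as lists *)

Section minkowski_monoid.
Variable V : zmodType.

Lemma minkowski_addA : associative (@minkowski_add V).
Proof.
move=> A B C; apply/seteqP; split.
  move=> _ [a Aa [_ [b Bb [c Cc <-]] <-]]; rewrite addrA.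
  by exists (a + b); [exists a => //; exists b|exists c].
move=> _ [_ [a Aa [b Bb <-]] [c Cc <-]]; rewrite -addrA.
by exists a => //; exists (b + c) => //; exists b => //; exists c.
Qed.

Lemma minkowski_addC : commutative (@minkowski_add V).
Proof.
by move=> A B; apply/seteqP; split=> _ [a Aa [b Bb <-]];
  rewrite addrC; exists b => //; exists a.
Qed.

Lemma minkowski_add0s : left_id [set 0] (@minkowski_add V).
Proof.
move=> A; apply/seteqP; split=> [_ [_ -> [b Bb <-]]|a Aa]; first by rewrite add0r.
by exists 0 => //; exists a => //; rewrite add0r.
Qed.

Lemma minkowski_addCA : left_commutative (@minkowski_add V).
Proof. by move=> A B C; rewrite !minkowski_addA (minkowski_addC A). Qed.

End minkowski_monoid.

(* A tagged partition as the list of the pairs (right endpoint, tag) of its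
   segments, the left endpoint [a] of the first one being given separately.
   Contrary to [tagged_partition], degenerate segments are allowed. *)
Section tagged_lists.
Variable R : realType.
Implicit Types (a d : R) (s : seq (R * R)).

Fixpoint tagged_path d a s : bool :=
  if s is p :: s' then
    [&& a <= p.2, p.2 <= p.1, p.1 - a <= d & tagged_path d p.1 s']
  else true.

Definition endpoint a s := last a (unzip1 s).

Lemma tagged_path_cat d a s1 s2 : tagged_path d a (s1 ++ s2) =
  tagged_path d a s1 && tagged_path d (endpoint a s1) s2.
Proof. by elim: s1 a => //= p s1 IH a; rewrite IH !andbA. Qed.

Lemma endpoint_cat a s1 s2 :
  endpoint a (s1 ++ s2) = endpoint (endpoint a s1) s2.
Proof. by rewrite /endpoint /unzip1 map_cat last_cat. Qed.

Lemma tagged_path_le d d' a s : d <= d' -> tagged_path d a s -> tagged_path d' a s.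
Proof.
move=> dd'; elim: s a => //= p s IH a /and4P[-> -> pd /IH ->].
by rewrite (le_trans pd).
Qed.

Lemma endpoint_ge d a s : tagged_path d a s -> a <= endpoint a s.
Proof.
elim: s a => //= p s IH a /and4P[ap pp _ /IH]; apply: le_trans.
exact: le_trans pp.
Qed.

Lemma tagged_pathP d a s : reflect
  (forall i, (i < size s)%N -> [/\ nth 0 (a :: unzip1 s) i <= nth 0 (unzip2 s) i,
     nth 0 (unzip2 s) i <= nth 0 (unzip1 s) i &
     nth 0 (unzip1 s) i - nth 0 (a :: unzip1 s) i <= d])
  (tagged_path d a s).
Proof.
elim: s a => [|p s IH] a /=; first exact: ReflectT.
apply: (iffP and4P) => [[h1 h2 h3 /IH h4] [|i]//= /h4//|H].
by have [h1 h2 h3] := H 0%N isT; split => //; apply/IH => i /(H i.+1).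
Qed.

Fixpoint uniform_tags (tag : R -> R -> R) a h n : seq (R * R) :=
  if n is n'.+1 then (a + h, tag a (a + h)) :: uniform_tags tag (a + h) h n'
  else [::].

Lemma endpoint_uniform_tags tag a h n :
  endpoint a (uniform_tags tag a h n) = a + n%:R * h.
Proof.
elim: n a => [|n IH] a /=; first by rewrite mul0r addr0.
rewrite [LHS](_ : _ = endpoint (a + h) (uniform_tags tag (a + h) h n))//.
by rewrite IH -addrA -[n.+1]add1n natrD mulrDl mul1r.
Qed.

Lemma tagged_path_uniform_tags tag a h n :
  (forall b, b <= tag b (b + h) <= b + h) ->
  tagged_path h a (uniform_tags tag a h n).
Proof.
move=> tagP; elim: n a => //= n IH a.
by have /andP[-> ->] := tagP a; rewrite IH addrAC subrr add0r lexx.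
Qed.

End tagged_lists.

Section tagged_sums.
Variables (R : realType) (X : normedModType R).
Implicit Types (a d : R) (s : seq (R * R)) (Phi : R -> R -> R -> set X).

(** Taking both endpoints and the tag as arguments of [Phi] covers Riemann sums, which read the tag,
    and convexified sums, which read the endpoints. *)
Fixpoint tagged_sum Phi a s : set X :=
  if s is p :: s' then
    minkowski_add (minkowski_scale (p.1 - a) (Phi a p.1 p.2)) (tagged_sum Phi p.1 s')
  else [set 0].

Lemma tagged_sum_cat Phi a s1 s2 : tagged_sum Phi a (s1 ++ s2) =
  minkowski_add (tagged_sum Phi a s1) (tagged_sum Phi (endpoint a s1) s2).
Proof.
elim: s1 a => [|p s1 IH] a /=; first by rewrite minkowski_add0s.
by rewrite IH minkowski_addA.
Qed.

Lemma tagged_sum_neq0 Phi a s : (forall b x t, Phi b x t !=set0) ->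
  tagged_sum Phi a s !=set0.
Proof.
move=> Phi0; elim: s a => [|p s IH] a /=; first by exists 0.
by apply: minkowski_add_neq0 => //; exact: minkowski_scale_neq0.
Qed.

Lemma tagged_sumE Phi a s : tagged_sum Phi a s =
  \big[@minkowski_add X/[set 0]]_(i < size (unzip1 s))
    minkowski_scale (nth 0 (unzip1 s) i - nth 0 (a :: unzip1 s) i)
      (Phi (nth 0 (a :: unzip1 s) i) (nth 0 (unzip1 s) i) (nth 0 (unzip2 s) i)).
Proof.
elim: s a => [|p s IH] a /=; first by rewrite big_ord0.
by rewrite big_ord_recl/= IH.
Qed.

Lemma tagged_path_of_partition (F : R -> set X) (P : tagged_partition R) :
  exists s, [/\ tagged_path (mesh P) 0 s, endpoint 0 s = 1 &
    tagged_sum (fun _ _ => F) 0 s = riemann_sum F P].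
Proof.
case: P => pts tg ptsP tgP.
pose tg' k := if insub k is Some i then tg i else 0.
have tg'E (i : 'I_(size pts)) : tg' i = tg i by rewrite /tg' valK.
pose s := mkseq (fun k => (nth 0 pts k, tg' k)) (size pts).
have s1 : unzip1 s = pts.
  by rewrite /s /unzip1 -map_comp; exact: mkseq_nth.
have s2 i : (i < size pts)%N -> nth 0 (unzip2 s) i = tg' i.
  by move=> ipts; rewrite /s /unzip2 -map_comp (nth_mkseq 0).
have ssz : size s = size pts by rewrite size_mkseq.
exists s; split.
- apply/tagged_pathP => i; rewrite ssz s1 => ipts; rewrite s2//.
  have := tgP (Ordinal ipts); rewrite -tg'E/= => /andP[h1 h2]; split => //.
  rewrite /mesh/=; apply: le_trans (@le_bigmax _ _ _ 0 (fun i => _) (Ordinal ipts)).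
  by rewrite /seg_length/=.
- by rewrite /endpoint s1; case: ptsP => _ /eqP.
rewrite tagged_sumE s1 /riemann_sum/=; apply: eq_bigr => i _.
by rewrite s2// tg'E.
Qed.

Fixpoint strict_tags a s : seq (R * R) :=
  if s is p :: s' then
    if p.1 == a then strict_tags a s' else p :: strict_tags p.1 s'
  else [::].

Lemma partition_of_tagged_path (F : R -> set X) d s : (forall t, F t !=set0) ->
  0 <= d -> tagged_path d 0 s -> endpoint 0 s = 1 ->
  exists P, mesh P <= d /\ riemann_sum F P = tagged_sum (fun _ _ => F) 0 s.
Proof.
move=> F0 d0 sP s1.
have [tP eP rE pP] : [/\ tagged_path d 0 (strict_tags 0 s),
   endpoint 0 (strict_tags 0 s) = 1,
   tagged_sum (fun _ _ => F) 0 (strict_tags 0 s) = tagged_sum (fun _ _ => F) 0 s &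
   path <%R 0 (unzip1 (strict_tags 0 s))].
  rewrite -s1; elim: s 0 sP {s1} => //= p s IH a /and4P[ap pp pd /IH[h1 h2 h3 h4]].
  have [pa|pa] := eqVneq p.1 a.
    rewrite -pa in h1 h2 h3 h4 *; split => //.
    by rewrite subrr minkowski_scale0// minkowski_add0s.
  rewrite /= ap pp pd h1 h3 h4 andbT; split => //.
  by rewrite lt_neqAle eq_sym pa (le_trans ap).
set s' := strict_tags 0 s in tP eP rE pP.
have ptsP : itv_partition 0 1 (unzip1 s') by split => //; exact/eqP.
have sz : size (unzip1 s') = size s' by rewrite size_map.
have tagP (i : 'I_(size (unzip1 s'))) : nth 0 (0 :: unzip1 s') i <=
    nth 0 (unzip2 s') i <= nth 0 (unzip1 s') i.
  have /tagged_pathP/(_ i) := tP; rewrite -sz => /(_ (ltn_ord i))[h1 h2 _].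
  by rewrite h1.
exists (@TaggedPartition R _ (fun i => nth 0 (unzip2 s') i) ptsP tagP).
split; last by rewrite -rE tagged_sumE.
apply: bigmax_le => // i _; rewrite /seg_length/=.
by have /tagged_pathP/(_ i) := tP; rewrite -sz => /(_ (ltn_ord i))[_ _].
Qed.

End tagged_sums.

(** * Convexified Riemann sums *)

Section unit_measure_itv.
Variable R : realType.
Implicit Types (A : set R).
Local Notation nu := (@unit_measure R).

Lemma unit_measure_itv_cat A (a b c : R) : measurable A -> a <= b -> b <= c ->
  nu (A `&` `]a, c]%classic) = nu (A `&` `]a, b]%classic) + nu (A `&` `]b, c]%classic).
Proof.
move=> mA ab bc; rewrite -unit_measureU; try exact: measurableI.
  rewrite -setIUr; congr (nu (_ `&` _)).
  apply/seteqP; split=> x /=; rewrite !in_itv/=.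
    by move=> /andP[ax xc]; case: (leP x b) => xb; [left|right]; apply/andP; split.
  by case=> /andP[h1 h2]; apply/andP; split; lra.
rewrite setIACA (_ : `]a, b]%classic `&` _ = set0) ?setI0//.
by rewrite -subset0 => x []/=; rewrite !in_itv/= => /andP[? ?] /andP[? ?]; lra.
Qed.

Lemma sum_unit_measure_tagged A d a s : measurable A -> tagged_path d a s ->
  \sum_(j < size (unzip1 s)) nu (A `&` `]nth 0 (a :: unzip1 s) j, nth 0 (unzip1 s) j]%classic)
  = nu (A `&` `]a, endpoint a s]%classic).
Proof.
move=> mA; elim: s a => [|p s IH] a /=.
  by move=> _; rewrite big_ord0 /endpoint/= set_itvoc0 setI0 unit_measure0.
move=> /and4P[ap pp _ sP]; rewrite big_ord_recl/= IH//.
by rewrite -unit_measure_itv_cat// ?(endpoint_ge sP)// (le_trans ap).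
Qed.

End unit_measure_itv.

Section level.
Variables (R : realType) (X : normedModType R).
Variables (F : R -> set X) (M : R) (v : nat -> seq X).
Hypothesis F0 : forall t, F t !=set0.
Hypothesis FM : forall t x, F t x -> `|x| <= M.
Hypothesis v0 : forall j, v j != [::].
Hypothesis vM : forall j y, y \in v j -> `|y| <= M.
Local Notation nu := (@unit_measure R).

Let M0 : 0 <= M.
Proof. by have [x /FM] := F0 0; exact: le_trans. Qed.

Definition locally_constant_on (K : set R) (d : R) (g : R -> nat) :=
  forall x y, K x -> K y -> `|x - y| < d -> g x = g y.

(** The label is read at some point of [K] in the segment, or at [a] if there is none. On short
    segments that meet [K], [cellE] shows that the choice of the point is immaterial. *)
Definition cell (K : set R) (g : R -> nat) (a b : R) : set X :=
  hull (v (g (xget a [set x | K x /\ a <= x <= b]))).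

Lemma cellE K d g a b x : locally_constant_on K d g -> b - a < d ->
  K x -> a <= x <= b -> cell K g a b = hull (v (g x)).
Proof.
move=> Kg bad Kx xab; rewrite /cell; case: xgetP => [y _ [Ky yab]|/(_ x)[]//].
by rewrite (Kg _ x)// ltr_norml; lra.
Qed.

Lemma cell_neq0 K g a b : cell K g a b !=set0.
Proof. exact: hull_neq0. Qed.

Lemma cell_convex K g a b : convex (cell K g a b).
Proof. exact: hull_convex. Qed.

Lemma norm_cell K g a b x : cell K g a b x -> `|x| <= M.
Proof. by apply: norm_hull => y; exact: vM. Qed.

Section two_levels.
Variables (e1 e2 d1 d2 : R) (K1 K2 : set R) (g1 g2 : R -> nat).
Hypotheses (e1_ge0 : 0 <= e1) (e2_ge0 : 0 <= e2).
Hypotheses (mK1 : measurable K1) (mK2 : measurable K2).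
Hypotheses (nK1 : nu (~` K1) <= e1) (nK2 : nu (~` K2) <= e2).
Hypotheses (K1g : locally_constant_on K1 d1 g1) (K2g : locally_constant_on K2 d2 g2).
Hypothesis approx : forall B, measurable B -> 0 < nu B -> exists t,
  [/\ B t, hausdorff_le e1 (F t) [set` v (g1 t)] &
    hausdorff_le e2 (F t) [set` v (g2 t)]].

(** Couple the two sums by the measures [w i j] of the overlaps of their segments. If an overlap
    meets both [K1] and [K2] in positive measure, it has a point [t] where [F t] is close to both
    labels, so the two hulls are close to each other. *)
Lemma cell_sum_close s1 s2 r1 r2 : r1 < d1 -> r2 < d2 ->
  tagged_path r1 0 s1 -> tagged_path r2 0 s2 ->
  endpoint 0 s1 = 1 -> endpoint 0 s2 = 1 ->
  hausdorff_le ((1 + 2 * M) * (e1 + e2))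
    (tagged_sum (fun a b _ => cell K1 g1 a b) 0 s1)
    (tagged_sum (fun a b _ => cell K2 g2 a b) 0 s2).
Proof.
move=> rd1 rd2 p1 p2 end1 end2.
pose I1 i := `]nth 0 (0 :: unzip1 s1) i, nth 0 (unzip1 s1) i]%classic.
pose I2 j := `]nth 0 (0 :: unzip1 s2) j, nth 0 (unzip1 s2) j]%classic.
pose K := K1 `&` K2.
have mK : measurable K by exact: measurableI.
have mI1 i : measurable (I1 i) by exact: measurable_itv.
have mI2 j : measurable (I2 j) by exact: measurable_itv.
have mI12 i j : measurable (I1 i `&` I2 j) by exact: measurableI.
pose w i j := nu (I1 i `&` I2 j).
pose b i j := nu ((I1 i `&` I2 j) `&` K).
pose e i j := if 0 < b i j then e1 + e2 else 2 * M.
have bounds (r : R) (s : seq (R * R)) i : tagged_path r 0 s -> endpoint 0 s = 1 -> (i < size (unzip1 s))%N ->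
    0 <= nth 0 (0 :: unzip1 s) i <= nth 0 (unzip1 s) i /\ nth 0 (unzip1 s) i <= 1.
  have gen (a c : R) : tagged_path r a s -> endpoint a s = c -> (i < size (unzip1 s))%N ->
    a <= nth 0 (a :: unzip1 s) i <= nth 0 (unzip1 s) i /\ nth 0 (unzip1 s) i <= c.
    move=> + <-; elim: s a i => //= p s IH a [|i] /= /and4P[ap pp _ sP] si.
      by rewrite lexx (le_trans ap)//; split => //; exact: endpoint_ge sP.
    have [/andP[h1 h2] h3] := IH _ _ sP si; rewrite h2 andbT; split => //.
    by rewrite (le_trans _ h1)// (le_trans ap).
  exact: gen.
have wsum1 i : (i < size (unzip1 s1))%N -> \sum_(j < size (unzip1 s2)) w i j =
    nth 0 (unzip1 s1) i - nth 0 (0 :: unzip1 s1) i.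
  move=> si; rewrite (sum_unit_measure_tagged (mI1 i) p2) end2.
  have [/andP[h1 h2] h3] := bounds _ _ _ p1 end1 si.
  rewrite setIidl ?unit_measure_itv// => x; rewrite /I1/= !in_itv/= => /andP[xl xr].
  by apply/andP; split; [exact: le_lt_trans xl|exact: le_trans h3].
have wsum2 j : (j < size (unzip1 s2))%N -> \sum_(i < size (unzip1 s1)) w i j =
    nth 0 (unzip1 s2) j - nth 0 (0 :: unzip1 s2) j.
  move=> sj; under eq_bigr => i _ do rewrite /w setIC.
  rewrite (sum_unit_measure_tagged (mI2 j) p1) end1.
  have [/andP[h1 h2] h3] := bounds _ _ _ p2 end2 sj.
  rewrite setIidl ?unit_measure_itv// => x; rewrite /I2/= !in_itv/= => /andP[xl xr].
  by apply/andP; split; [exact: le_lt_trans xl|exact: le_trans h3].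
have close i j : (i < size (unzip1 s1))%N -> (j < size (unzip1 s2))%N ->
    hausdorff_le (e i j) (cell K1 g1 (nth 0 (0 :: unzip1 s1) i) (nth 0 (unzip1 s1) i))
      (cell K2 g2 (nth 0 (0 :: unzip1 s2) j) (nth 0 (unzip1 s2) j)).
  move=> si sj; rewrite /e; case: ifPn => [bij|_]; last first.
    by apply: hausdorff_le_bounded; try exact: cell_neq0; move=> x; exact: norm_cell.
  have [t [[[]]]] := approx (measurableI _ _ (mI12 i j) mK) bij.
  rewrite /I1 /I2/= !in_itv/= => /andP[/ltW t1 t2] /andP[/ltW t3 t4] [K1t K2t] h1 h2.
  have /tagged_pathP/(_ i) := p1; rewrite -(size_map fst) => /(_ si)[_ _ l1].
  have /tagged_pathP/(_ j) := p2; rewrite -(size_map fst) => /(_ sj)[_ _ l2].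
  rewrite (cellE (x := t) K1g)// ?t1// ?(le_lt_trans l1)//.
  rewrite (cellE (x := t) K2g)// ?t3// ?(le_lt_trans l2)//.
  apply: hausdorff_le_hull => //.
  by apply: hausdorff_le_trans h2; exact: hausdorff_le_sym.
rewrite !tagged_sumE.
pose C i := cell K1 g1 (nth 0 (0 :: unzip1 s1) i) (nth 0 (unzip1 s1) i).
pose D j := cell K2 g2 (nth 0 (0 :: unzip1 s2) j) (nth 0 (unzip1 s2) j).
rewrite (eq_bigr (fun i : 'I_(size (unzip1 s1)) =>
  minkowski_scale (\sum_(j < size (unzip1 s2)) w i j) (C i))); last first.
  by move=> i _; rewrite wsum1.
rewrite [X in hausdorff_le _ _ X](eq_bigr (fun j : 'I_(size (unzip1 s2)) =>
  minkowski_scale (\sum_(i < size (unzip1 s1)) w i j) (D j))); last first.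
  by move=> j _; rewrite wsum2.
apply: (@hausdorff_le_mono _ _
    (\sum_(i < size (unzip1 s1)) \sum_(j < size (unzip1 s2)) w i j * e i j)); last first.
  apply: minkowski_coupling => //; try by move=> i; exact: cell_neq0.
  - by move=> i j; exact: unit_measure_ge0.
  - by move=> i; exact: cell_convex.
  - by move=> i; exact: cell_convex.
pose c i j := nu ((I1 i `&` I2 j) `\` K).
have wbc i j : w i j = b i j + c i j by exact: unit_measure_split.
(* If [b i j] vanishes, then [w i j] equals [c i j], and the crude bound [2 * M] is charged to the
   part of the overlap outside [K]. *)
have wle i j : w i j * e i j <= (e1 + e2) * w i j + 2 * M * c i j.
  have c0 : 0 <= c i j := unit_measure_ge0 _.
  have b0 : 0 <= b i j := unit_measure_ge0 _.
  rewrite /e; case: ifPn => [bij|].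
    by have := mulr_ge0 M0 c0; lra.
  rewrite -leNgt => bij; have bE : b i j = 0 by lra.
  rewrite wbc bE add0r; have := mulr_ge0 (addr_ge0 e1_ge0 e2_ge0) c0; lra.
apply: (@le_trans _ _ (\sum_(i < size (unzip1 s1)) \sum_(j < size (unzip1 s2))
    ((e1 + e2) * w i j + 2 * M * c i j))).
  by apply: ler_sum => i _; apply: ler_sum => j _; exact: wle.
have sw : \sum_(i < size (unzip1 s1)) \sum_(j < size (unzip1 s2)) w i j = 1.
  under eq_bigr => i _ do rewrite (sum_unit_measure_tagged (mI1 i) p2) end2 setIC.
  rewrite (sum_unit_measure_tagged _ p1) ?end1; last exact: measurable_itv.
  by rewrite setIid unit_measure_itv// subr0.
have sc : \sum_(i < size (unzip1 s1)) \sum_(j < size (unzip1 s2)) c i j <= e1 + e2.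
  have mKC : measurable (~` K) by exact: measurableC.
  have mKI i : measurable (~` K `&` I1 i) by exact: measurableI.
  have -> : \sum_(i < size (unzip1 s1)) \sum_(j < size (unzip1 s2)) c i j =
      nu (~` K `&` `]0, 1]%classic `&` `]0, 1]%classic).
    under eq_bigr => i _.
      under eq_bigr => j _ do rewrite /c setDE setIC setIA.
      rewrite (sum_unit_measure_tagged (mKI i) p2) end2 setIAC.
      over.
    rewrite (sum_unit_measure_tagged _ p1) ?end1//.
    by apply: measurableI => //; exact: measurable_itv.
  have mI : measurable (`]0, 1]%classic : set R) by exact: measurable_itv.
  apply: (@le_trans _ _ (nu (~` K))).
    by apply: le_unit_measure => //; [apply: measurableI => //; exact: measurableI
      |move=> x [[]]].
  rewrite /K setCI.
  have m1 : measurable (~` K1) by exact: measurableC.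
  have m2 : measurable (~` K2) by exact: measurableC.
  have mU := measurableU _ _ m1 m2.
  rewrite (unit_measure_split mU m1) lerD//.
    by apply: le_trans nK1; apply: le_unit_measure => //; exact: measurableI.
  apply: le_trans nK2; apply: le_unit_measure => //; first exact: measurableD.
  by move=> x [[]].
under eq_bigr => i _ do rewrite big_split/= -!mulr_sumr.
rewrite big_split/= -!mulr_sumr sw.
have := ler_wpM2l (mulr_ge0 (ler0n _ 2) M0) sc; lra.
Qed.

End two_levels.
End level.

(** * Refinement of a tagged partition by well-chosen tags *)

Section refinement.
Variables (R : realType) (X : normedModType R).
Variables (F : R -> set X) (M : R) (v : nat -> seq X).
Hypothesis F0 : forall t, F t !=set0.
Hypothesis FM : forall t x, F t x -> `|x| <= M.
Hypothesis v0 : forall j, v j != [::].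
Hypothesis vM : forall j y, y \in v j -> `|y| <= M.
Local Notation nu := (@unit_measure R).
Variables (e d : R) (K : set R) (g : R -> nat).
Hypothesis e_gt0 : 0 < e.
Hypothesis mK : measurable K.
Hypothesis Kg : locally_constant_on K d g.
Hypothesis approx : forall B, measurable B -> 0 < nu B -> exists2 t,
  B t & hausdorff_le e (F t) [set` v (g t)].

Let M0 : 0 <= M.
Proof. by have [x /FM] := F0 0; exact: le_trans. Qed.

(** The default value [a] occurs only if [K] meets []a, b]] in a null set, by [approx]. *)
Let goodtag a b := xget a [set t | [/\ a <= t <= b, K t &
  hausdorff_le e (F t) [set` v (g t)]]].

Let goodtagP a b : a <= b -> a <= goodtag a b <= b.
Proof. by move=> ab; rewrite /goodtag; case: xgetP => [_ _ []//|_]; rewrite lexx. Qed.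

(** This bound is additive over consecutive segments, so errors can be summed along a list without
    loss. *)
Let err a b := e * (b - a) + 2 * M * nu (~` K `&` `]a, b]%classic).

Let mKC : measurable (~` K). Proof. exact: measurableC. Qed.

Let err_ge0 a b : a <= b -> 0 <= err a b.
Proof.
move=> ab; rewrite /err addr_ge0// mulr_ge0 ?subr_ge0 ?(ltW e_gt0)//.
  by rewrite mulr_ge0.
exact: unit_measure_ge0.
Qed.

Let err_cat a b c : a <= b -> b <= c -> err a c = err a b + err b c.
Proof. by move=> ab bc; rewrite /err (unit_measure_itv_cat mKC ab bc); lra. Qed.

(** If [K] has measure zero in the segment, the complement of [K] fills it, and the second term of
    [err] pays for the crude bound [2 * M]. *)
Let close_segment a b c : 0 <= a -> a <= b -> b <= 1 ->
  (forall x, K x -> a <= x <= b -> g x = c) ->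
  hausdorff_le (err a b) (minkowski_scale (b - a) (F (goodtag a b)))
    (minkowski_scale (b - a) [set` v c]).
Proof.
move=> a0 ab b1 Kc; have ba0 : 0 <= b - a by rewrite subr_ge0.
have mab : measurable (`]a, b]%classic : set R) by exact: measurable_itv.
have mabK := measurableI _ _ mab mK.
have split := unit_measure_split mab mK.
rewrite unit_measure_itv// setDE (setIC _ (~` K)) in split.
have n1 := unit_measure_ge0 (`]a, b] `&` K).
have n2 := unit_measure_ge0 (~` K `&` `]a, b]).
have [nab|nab] := ltP 0 (nu (`]a, b] `&` K)).
  have [t [/= tab Kt] Ft] := approx mabK nab.
  have [gab Kgt Fg] : [/\ a <= goodtag a b <= b, K (goodtag a b) &
      hausdorff_le e (F (goodtag a b)) [set` v (g (goodtag a b))]].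
    rewrite /goodtag; case: xgetP => [_ _ //|/(_ t)[]]; split => //.
    by rewrite in_itv/= in tab; have /andP[/ltW -> ->] := tab.
  rewrite (Kc _ Kgt gab) in Fg.
  apply: hausdorff_le_mono (hausdorff_leZ ba0 Fg).
  by rewrite /err; have := mulr_ge0 M0 n2; lra.
apply: (@hausdorff_le_mono _ _ ((b - a) * (2 * M))).
  rewrite /err (_ : nu (~` K `&` `]a, b]) = b - a); last by lra.
  by have := mulr_ge0 (ltW e_gt0) ba0; lra.
apply: hausdorff_leZ => //; apply: hausdorff_le_bounded => //.
- have : v c != [::] by [].
  by case: (v c) => // y l _; exists y; rewrite /= mem_head.
- by move=> x; exact: FM.
- by move=> x /= xv; exact: vM xv.
Qed.

Let close_uniform a h n c : 0 <= a -> 0 <= h -> a + n%:R * h <= 1 ->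
  (forall x, K x -> a <= x <= a + n%:R * h -> g x = c) ->
  let s := uniform_tags goodtag a h n in
  hausdorff_le (err a (a + n%:R * h)) (tagged_sum (fun _ _ => F) a s)
    (tagged_sum (fun _ _ _ => [set` v c]) a s).
Proof.
move=> + h0; elim: n a => [|n IH] a a0 /=.
  by move=> _ _; rewrite mul0r addr0; exact/hausdorff_le_refl/err_ge0.
have nh0 : 0 <= n%:R * h by rewrite mulr_ge0.
have -> : a + n.+1%:R * h = (a + h) + n%:R * h by rewrite -natr1; ring.
move=> ah1 Kc; rewrite (@err_cat a (a + h)); [|lra|lra].
apply: hausdorff_leD.
  by apply: close_segment; [lra|lra|lra|move=> x Kx xa; apply: Kc => //; lra].
by apply: IH => //; [lra|move=> x Kx xa; apply: Kc => //; lra].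
Qed.

Let uniform_tags_sum tag a h n (V : set X) x :
  tagged_sum (fun _ _ _ => V) a (uniform_tags tag a h n) x <->
  exists l : seq X, [/\ size l = n, (forall y, y \in l -> V y) & x = h *: \sum_(y <- l) y].
Proof.
elim: n a x => [|n IH] a x /=.
  split=> [->|[l [/size0nil -> _ ->]]]; last by rewrite big_nil scaler0.
  by exists [::]; rewrite big_nil scaler0.
rewrite (_ : a + h - a = h); last by ring.
split=> [[_ [y Vy <-] [_ /IH[l [sl lV ->]] <-]]|[[|y l] [//= [sl] lV ->]]].
  exists (y :: l); split; rewrite /= ?sl ?big_cons ?scalerDr//.
  by move=> z; rewrite inE => /orP[/eqP ->//|]; exact: lV.
rewrite big_cons scalerDr; exists (h *: y).
  by exists y => //; apply: lV; rewrite mem_head.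
exists (h *: \sum_(j <- l) j) => //; apply/IH; exists l; split => // z zl.
by apply: lV; rewrite inE zl orbT.
Qed.

(** The error is proportional to the length [h] of one piece, hence small when a given interval is
    cut into many pieces. *)
Let uniform_tags_hull tag a h n c : 0 <= h ->
  hausdorff_le (h * (2 * (size (v c))%:R * M))
    (tagged_sum (fun _ _ _ => [set` v c]) a (uniform_tags tag a h n))
    (minkowski_scale (n%:R * h) (hull (v c))).
Proof.
move=> h0; split=> [x /uniform_tags_sum[l [sl lV ->]]|_ [x vx <-]].
  have [y vy ->] := hull_scale_sum (v0 c) lV.
  exists ((n%:R * h) *: y); first by exists y.
  by rewrite scalerA sl mulrC subrr normr0 !mulr_ge0.
have [l [sl lV le]] := hull_rounding n (@vM c) (v0 c) vx.
exists (h *: \sum_(y <- l) y); first by apply/uniform_tags_sum; exists l.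
by rewrite mulrC -scalerA -scalerBr normrZ ger0_norm// distrC ler_wpM2l.
Qed.

Let minkowski_scale_set0 t : minkowski_scale t [set 0 : X] = [set 0].
Proof.
apply/seteqP; split=> [_ [_ -> <-]|_ ->]; first by rewrite scaler0.
by exists 0 => //; rewrite scaler0.
Qed.

Lemma fill_segment a b c : 0 <= a -> a <= b -> b <= 1 ->
  (forall x, K x -> a <= x <= b -> g x = c) ->
  exists s, [/\ tagged_path (b - a) a s, endpoint a s = b &
    hausdorff_le (2 * e * (b - a) + 2 * M * nu (~` K `&` `]a, b]%classic))
      (tagged_sum (fun _ _ => F) a s) (minkowski_scale (b - a) (hull (v c)))].
Proof.
move=> a0 ab b1 Kc.
pose q : R := 2 * (size (v c))%:R * M.
have q0 : 0 <= q by rewrite /q !mulr_ge0.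
(* With this many pieces the convexification error [h * q] is at most [e * (b - a)]; together with
   [err a b] it gives the factor 2 in front of [e]. *)
pose n := (Num.truncn (q / e)).+1.
have nq : q / e < n%:R by rewrite truncnS_gt.
have n0 : 0 < n%:R :> R by rewrite ltr0n.
pose h := (b - a) / n%:R.
have ba0 : 0 <= b - a by rewrite subr_ge0.
have h0 : 0 <= h by rewrite divr_ge0// ltW.
have nh : n%:R * h = b - a by rewrite /h mulrC divfK// gt_eqF.
have anh : a + n%:R * h = b by rewrite nh; ring.
exists (uniform_tags goodtag a h n); split.
- apply: (@tagged_path_le _ h).
    by rewrite -nh ler_peMl// ler1n.
  by apply: tagged_path_uniform_tags => x; apply: goodtagP; lra.
- by rewrite endpoint_uniform_tags.
apply: (@hausdorff_le_mono _ _ (err a b + h * q)).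
  suff : h * q <= e * (b - a) by rewrite /err; lra.
  have qn : q <= n%:R * e by rewrite -ler_pdivrMr// ltW.
  rewrite -nh (_ : e * (n%:R * h) = h * (n%:R * e)); last by ring.
  by rewrite ler_wpM2l.
apply: (hausdorff_le_trans (B := tagged_sum (fun _ _ _ => [set` v c]) a
  (uniform_tags goodtag a h n))); last first.
  by rewrite -nh; exact: uniform_tags_hull.
by rewrite -{1}anh; apply: close_uniform => //; rewrite anh.
Qed.

Let err2 a b := 2 * e * (b - a) + 2 * M * nu (~` K `&` `]a, b]%classic).

Let err2_ge0 a b : a <= b -> 0 <= err2 a b.
Proof.
move=> ab; have := err_ge0 ab; rewrite /err2 /err.
by have : 0 <= e * (b - a) by [rewrite mulr_ge0 ?subr_ge0// ltW]; lra.
Qed.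

Let err2_cat a b c : a <= b -> b <= c -> err2 a c = err2 a b + err2 b c.
Proof. by move=> ab bc; rewrite /err2 (unit_measure_itv_cat mKC ab bc); lra. Qed.

Let minkowski_scaleA s t (A : set X) :
  minkowski_scale s (minkowski_scale t A) = minkowski_scale (s * t) A.
Proof.
apply/seteqP; split=> [_ [_ [a Aa <-] <-]|_ [a Aa <-]].
  by exists a => //; rewrite scalerA.
by exists (t *: a); [exists a|rewrite scalerA].
Qed.

Let minkowski_scaleDr t (A B : set X) : minkowski_scale t (minkowski_add A B) =
  minkowski_add (minkowski_scale t A) (minkowski_scale t B).
Proof.
apply/seteqP; split=> [_ [_ [a Aa [b Bb <-]] <-]|_ [_ [a Aa <-] [_ [b Bb <-] <-]]].
  by rewrite scalerDr; exists (t *: a); [exists a|exists (t *: b) => //; exists b].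
by rewrite -scalerDr; exists (a + b) => //; exists a => //; exists b.
Qed.

Let convex_scaleD s t (C : set X) : convex C -> C !=set0 -> 0 <= s -> 0 <= t ->
  minkowski_add (minkowski_scale s C) (minkowski_scale t C) = minkowski_scale (s + t) C.
Proof.
move=> cC C0 s0 t0; apply/seteqP; split.
  move=> _ [_ [x Cx <-] [_ [y Cy <-] <-]].
  have [|b|c Cc] := @convex_sum _ _ C _ (index_enum bool) predT
    (fun b => if b then s else t) (fun b => if b then x else y) cC C0.
  - by case.
  - by case: b.
  by rewrite !big_bool/= => ->; exists c.
move=> _ [x Cx <-]; rewrite scalerDl; exists (s *: x); first by exists x.
by exists (t *: x) => //; exists x.
Qed.

(* Each segment [a, x] with tag t is shrunk around t by the factor 1 - l, and
   the two freed intervals, of total length l (x - a), are filled so as to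
   contribute almost l times the convexified sum. *)
Lemma star_refinement l r a s : 0 <= l <= 1 -> r < d ->
  0 <= a -> tagged_path r a s -> endpoint a s <= 1 ->
  exists s', [/\ tagged_path r a s', endpoint a s' = endpoint a s &
    hausdorff_le (err2 a (endpoint a s)) (tagged_sum (fun _ _ => F) a s')
      (minkowski_add (minkowski_scale l (tagged_sum (fun a b _ => cell v K g a b) a s))
        (minkowski_scale (1 - l) (tagged_sum (fun _ _ => F) a s)))].
Proof.
move=> /andP[l0 l1] rd; elim: s a => [|[x t] s IH] a a0 /=.
  move=> _ _; exists [::]; split => //=.
  rewrite !minkowski_scale_set0 minkowski_add0s.
  by apply/hausdorff_le_refl/err2_ge0; rewrite lexx.
move=> /and4P[at_ tx xr sP] end1.
have xe : x <= endpoint x s := endpoint_ge sP.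
have eE : endpoint a ((x, t) :: s) = endpoint x s by [].
rewrite eE in end1 *.
have [|s0 [s0P s0e s0c]] := IH x _ sP end1; first by lra.
pose p := a + l * (t - a); pose q := x - l * (x - t).
have h1 : 0 <= l * (t - a) by rewrite mulr_ge0// subr_ge0.
have h2 : 0 <= l * (x - t) by rewrite mulr_ge0// subr_ge0.
have h3 : l * (t - a) <= t - a by rewrite ler_piMl// subr_ge0.
have h4 : l * (x - t) <= x - t by rewrite ler_piMl// subr_ge0.
pose C := cell v K g a x.
(* The same choice as in the definition of [cell], so that [C] is [hull (v c)] by conversion. *)
pose c := g (xget a [set y | K y /\ a <= y <= x]).
have Kc y : K y -> a <= y <= x -> g y = c.
  move=> Ky ayx; rewrite /c; case: xgetP => [z _ [Kz az]|/(_ y)[]//].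
  by apply: Kg => //; rewrite ltr_norml; lra.
have [ap pt tq qx] : [/\ a <= p, p <= t, t <= q & q <= x].
  by split; rewrite /p /q; lra.
have p1 : p <= 1 by lra.
have q0 : 0 <= q by lra.
have x1 : x <= 1 by lra.
have Kap y : K y -> a <= y <= p -> g y = c by move=> Ky ya; apply: Kc => //; lra.
have Kqx y : K y -> q <= y <= x -> g y = c by move=> Ky ya; apply: Kc => //; lra.
have [s1 [s1P s1e s1c]] := fill_segment a0 ap p1 Kap.
have [s2 [s2P s2e s2c]] := fill_segment q0 qx x1 Kqx.
exists (s1 ++ (q, t) :: s2 ++ s0); split.
- rewrite tagged_path_cat s1e/= tagged_path_cat s2e s0P.
  rewrite (tagged_path_le _ s1P) ?(tagged_path_le _ s2P)/p/q//=; lra.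
- by rewrite endpoint_cat s1e /endpoint/= -/(endpoint q (s2 ++ s0)) endpoint_cat s2e.
rewrite tagged_sum_cat s1e/= tagged_sum_cat s2e.
set FS := tagged_sum (fun _ _ => F) x s in s0c *.
set CS := tagged_sum _ x s in s0c *.
have -> : minkowski_add
    (minkowski_scale l (minkowski_add (minkowski_scale (x - a) C) CS))
    (minkowski_scale (1 - l) (minkowski_add (minkowski_scale (x - a) (F t)) FS)) =
  minkowski_add (minkowski_scale (p - a) C) (minkowski_add (minkowski_scale (q - p) (F t))
    (minkowski_add (minkowski_scale (x - q) C)
      (minkowski_add (minkowski_scale l CS) (minkowski_scale (1 - l) FS)))).
  rewrite !minkowski_scaleDr !minkowski_scaleA.
  rewrite (_ : (1 - l) * (x - a) = q - p); last by rewrite /p /q; ring.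
  rewrite (_ : l * (x - a) = (p - a) + (x - q)); last by rewrite /p /q; ring.
  (* Convexity of [C] lets its multiple be shared between the two freed intervals. *)
  rewrite -convex_scaleD; last first.
  - by rewrite /q; lra.
  - by rewrite /p; lra.
  - exact: cell_neq0.
  - exact: cell_convex.
  rewrite -!minkowski_addA; congr minkowski_add.
  by rewrite (minkowski_addCA (minkowski_scale l CS)) (minkowski_addCA (minkowski_scale (x - q) C)).
have xq : x - q >= 0 by rewrite /q; lra.
(* The middle segment, with tag [t], is reproduced exactly and has error 0. *)
apply: (@hausdorff_le_mono _ _ (err2 a p + (0 + (err2 q x + err2 x (endpoint x s))))).
  have := @err2_cat a x (endpoint x s); have := @err2_cat a p x.
  have := @err2_cat p q x; have := @err2_ge0 p q.
  rewrite /p /q; lra.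
apply: hausdorff_leD; first exact: s1c.
apply: hausdorff_leD; first exact: hausdorff_le_refl.
by apply: hausdorff_leD; first exact: s2c.
Qed.

End refinement.

(** * The center of the star *)

Section riemann_limits_characterization.
Variables (R : realType) (X : normedModType R) (F : R -> set X).
Hypothesis F0 : forall t, F t !=set0.

Lemma riemann_sum_neq0 P : riemann_sum F P !=set0.
Proof.
rewrite /riemann_sum; elim/big_ind: _ => [|A B|i _]; first by exists 0.
  exact: minkowski_add_neq0.
exact: minkowski_scale_neq0.
Qed.

Lemma mesh_ge0 (P : tagged_partition R) : 0 <= mesh P.
Proof. exact: bigmax_ge_id. Qed.

Lemma riemann_limitsI A : A !=set0 -> closed A ->
  (forall e, 0 < e -> exists P, mesh P < e /\ hausdorff_le e (riemann_sum F P) A) ->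
  riemann_limits F A.
Proof.
move=> A0 clA approx; split => //.
(* Halving leaves room for the strict inequality in [hausdorff_dist_le]. *)
have e0 k : 0 < k.+1%:R^-1 / 2 :> R by rewrite divr_gt0// invr_gt0.
have /choice[P PP] : forall k : nat, exists P, mesh P < k.+1%:R^-1 / 2 /\
    hausdorff_le (k.+1%:R^-1 / 2) (riemann_sum F P) A by move=> k; exact: approx.
have lt k : k.+1%:R^-1 / 2 < k.+1%:R^-1 :> R by move: (e0 k); move: (_^-1) => x; lra.
exists P; split.
  apply: (@squeeze_cvgr _ _ _ _ (fun=> 0) (fun k => k.+1%:R^-1)).
  - apply: nearW => k; rewrite mesh_ge0/=; have [/ltW h _] := PP k.
    by rewrite (le_trans h)// ltW.
  - exact: cvg_cst.
  - exact: cvg_harmonic.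
apply: (@squeeze_cvge _ _ _ _ (fun=> 0%E) _ (fun k => k.+1%:R^-1%:E)).
- apply: nearW => k; apply/andP; split.
    by apply: hausdorff_dist_ge0; exact: riemann_sum_neq0.
  by apply: hausdorff_dist_le (PP k).2; rewrite ?invr_gt0.
- exact: cvg_cst.
- by apply: cvg_EFin; [exact: nearW|exact: cvg_harmonic].
Qed.

Lemma riemann_limitsE A e : riemann_limits F A -> 0 < e ->
  exists P, mesh P < e /\ hausdorff_le e (riemann_sum F P) A.
Proof.
move=> [_ _ [P [mP hP]]] e0.
have /cvgrPdist_lt/(_ e e0) mPe := mP.
have hPe : \forall k \near \oo, (hausdorff_dist (riemann_sum F (P k)) A < e%:E)%E.
  apply: (hP [set x | (x < e%:E)%E]); apply: open_nbhs_nbhs.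
  by split; [exact: open_ereal_lt_ereal|rewrite /= lte_fin].
have [k [/= h1 h2]] := filter_ex (filterI mPe hPe).
exists (P k); split; last exact: hausdorff_dist_lt.
by rewrite sub0r normrN ger0_norm ?mesh_ge0 in h1.
Qed.

Lemma compact_riemann_sum P : (forall t, compact (F t)) -> compact (riemann_sum F P).
Proof.
move=> cF; rewrite /riemann_sum; elim/big_ind: _ => [|A B|i _].
- exact: compact_set1.
- exact: compact_minkowski_add.
- exact: compact_minkowski_scale.
Qed.

End riemann_limits_characterization.

Lemma uniform_tagged_path (R : realType) (d : R) : 0 < d ->
  exists s, tagged_path d 0 s /\ endpoint 0 s = 1.
Proof.
move=> d0; pose n := (Num.truncn d^-1).+1.
have n0 : 0 < n%:R :> R by rewrite ltr0n.
have nd : d^-1 < n%:R by rewrite truncnS_gt.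
have h0 : 0 <= n%:R^-1 :> R by rewrite invr_ge0 ltW.
exists (uniform_tags (fun a _ => a) 0 n%:R^-1 n); split; last first.
  by rewrite endpoint_uniform_tags add0r divff// gt_eqF.
apply: (@tagged_path_le _ n%:R^-1).
  by rewrite -[leRHS]invrK lef_pV2 ?posrE ?invr_gt0// ltW.
by apply: tagged_path_uniform_tags => b; rewrite lexx lerDl.
Qed.

(** [A0] is the limit of the convexified sums over fixed partitions [s m]. For a given [e], one
    level [m] is selected, and [star_refinement] is applied at that level to the given partition. *)
Lemma riemann_star_center (R : realType) (X : completeNormedModType R)
  (F : R -> set X) (M : R) : separable X ->
  (forall t, F t !=set0) -> (forall t, compact (F t)) ->
  (forall t x, F t x -> `|x| <= M) ->
  exists A0, [/\ A0 !=set0, closed A0 & forall e, 0 < e -> exists2 d, 0 < d &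
    forall P0 l, mesh P0 < d -> 0 <= l <= 1 -> exists P, mesh P < e /\
      hausdorff_le e (riemann_sum F P)
        (minkowski_add (minkowski_scale l A0) (minkowski_scale (1 - l) (riemann_sum F P0)))].
Proof.
move=> sepX F0 cF FM.
have M0 : 0 <= M by have [x /FM] := F0 0; exact: le_trans.
have [v [v0 vM vd]] := separable_finite_net sepX M0.
have [t e _ e0|g [mg gP]] := @measurable_approximation R X F v.
  by apply: vd => //; exact: FM.
have FM1 t x : F t x -> `|x| <= M + 1 by move=> /FM; lra.
pose eps m : R := 2^-1 ^+ m.
have eps0 m : 0 < eps m by rewrite exprn_gt0// invr_gt0.
have eps_le m l : (m <= l)%N -> eps l <= eps m.
  by move=> ml; rewrite ler_wiXn2l ?invr_ge0// ?invf_le1 ?ler1n// ltnW.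
have /choice[Kd KdP] : forall m, exists Kd : set R * R, [/\ measurable Kd.1,
    0 < Kd.2, unit_measure (~` Kd.1) <= eps m & locally_constant_on Kd.1 Kd.2 (g m)].
  by move=> m; have [K [d h]] := lusin_nat (mg m) (eps0 m); exists (K, d).
have /choice[s sP] : forall m, exists s, tagged_path ((Kd m).2 / 2) 0 s /\ endpoint 0 s = 1.
  move=> m; apply: uniform_tagged_path.
  by have [_ d0 _ _] := KdP m; rewrite divr_gt0.
pose convex_sum_of m s := tagged_sum (fun a b _ => cell v (Kd m).1 (g m) a b) 0 s.
(* The factor 2 absorbs [eps m + eps l], as [eps l] is at most [eps m]; the bound is [M + 1] because
   of the vertices in [v]. *)
pose c := 2 * (1 + 2 * (M + 1)).
have close m l s1 s2 r1 r2 : (m <= l)%N -> r1 < (Kd m).2 -> r2 < (Kd l).2 ->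
    tagged_path r1 0 s1 -> tagged_path r2 0 s2 ->
    endpoint 0 s1 = 1 -> endpoint 0 s2 = 1 ->
    hausdorff_le (c * eps m) (convex_sum_of m s1) (convex_sum_of l s2).
  move=> ml r1d r2d p1 p2 end1 end2.
  have [mK1 d1 nK1 Kg1] := KdP m; have [mK2 d2 nK2 Kg2] := KdP l.
  apply: (@hausdorff_le_mono _ _ ((1 + 2 * (M + 1)) * (eps m + eps l))).
    rewrite /c -mulrA mulrCA ler_wpM2l//; first by lra.
    by have := eps_le _ _ ml; lra.
  apply: (@cell_sum_close _ _ F (M + 1) v F0 FM1 v0 vM _ _ _ _ _ _ _ _
    (ltW (eps0 m)) (ltW (eps0 l)) mK1 mK2 nK1 nK2 Kg1 Kg2 _ s1 s2 r1 r2) => //.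
  by move=> B mB B0; have [t [_ h1 h2 h3]] := gP m l B mB B0; exists t.
have half m : (Kd m).2 / 2 < (Kd m).2 by have [_ d0 _ _] := KdP m; lra.
have c0 : 0 <= c by rewrite /c; lra.
have [m|m|A0 [A00 clA0 A0P]] := @hausdorff_limit _ X (fun m => convex_sum_of m (s m)) c c0.
- by apply: tagged_sum_neq0 => *; exact: cell_neq0.
- move=> l ml; have [p1 e1] := sP m; have [p2 e2] := sP l.
  exact: close (half m) (half l) p1 p2 e1 e2.
exists A0; split => // e e0.
(* The budget in units of [eps m]: [2 + 2 * (M + 1)] for the refinement, [c] for passing from the
   given partition to [s m], and [3 * c + 1] for passing to the limit. *)
pose B := 2 + 2 * (M + 1) + c + (3 * c + 1).
have B0 : 0 < B by rewrite /B; lra.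
have [m mB] : exists m, eps m * B <= e.
  have h1 : `|2^-1| < 1 :> R by rewrite ger0_norm ?invr_ge0// invf_lt1// ltr1n.
  have eB : 0 < e / B by rewrite divr_gt0.
  have /cvgrPdist_lt/(_ _ eB)[m _ /(_ m (leqnn m))/=] := cvg_expr h1.
  rewrite sub0r normrN ger0_norm ?(ltW (eps0 m))// => lt.
  by exists m; rewrite -ler_pdivlMr// ltW.
have [mK d0 nK Kg] := KdP m.
(* The first bound makes the labels constant on the part of each segment inside [K]; the second is
   inherited by the mesh of the refinement. *)
exists (Num.min (Kd m).2 e); first by rewrite lt_min d0.
move=> P0 l; rewrite lt_min => /andP[P0d P0e] l01.
have [s0 [s0p s0e s0E]] := tagged_path_of_partition F P0.
have approx1 B' : measurable B' -> 0 < unit_measure B' -> exists2 t,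
    B' t & hausdorff_le (eps m) (F t) [set` v (g m t)].
  by move=> mB' B'0; have [t [_ h1 h2 _]] := gP m m B' mB' B'0; exists t.
have s0e1 : endpoint 0 s0 <= 1 by rewrite s0e.
have [s' [s'p s'e s'c]] := @star_refinement _ X F (M + 1) v F0 FM1 v0 vM (eps m) _ _ _
  (eps0 m) mK Kg approx1 l (mesh P0) 0 s0 l01 P0d (lexx 0) s0p s0e1.
rewrite s0e in s'e s'c.
have [P [Pm PE]] := partition_of_tagged_path F0 (mesh_ge0 P0) s'p s'e.
exists P; split; first exact: le_lt_trans P0e.
rewrite PE -s0E.
have [p1 e1] := sP m.
have UA : hausdorff_le (c * eps m + (3 * c * eps m + eps m)) (convex_sum_of m s0) A0.
  apply: hausdorff_le_trans (A0P m).
  exact: (close m m _ _ _ _ (leqnn m) P0d (half m)).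
have /andP[l0 l1] := l01.
apply: (hausdorff_le_mono _ (hausdorff_le_trans s'c (hausdorff_leD (hausdorff_leZ l0 UA)
  (hausdorff_le_refl _ (lexx 0))))).
rewrite addr0; apply: le_trans mB.
have nK1 : unit_measure (~` (Kd m).1 `&` `]0, 1]%classic) <= eps m.
  apply: le_trans nK; apply: le_unit_measure; last exact: subIsetl.
    by apply: measurableI; [exact: measurableC|exact: measurable_itv].
  exact: measurableC.
rewrite subr0 mulr1.
have M1 : 0 <= M + 1 by lra.
have h1 := ler_wpM2l M1 nK1.
have h2 : l * (c * eps m + (3 * c * eps m + eps m)) <= c * eps m + (3 * c * eps m + eps m).
  rewrite ler_piMl//; have := mulr_ge0 c0 (ltW (eps0 m)); have := eps0 m; lra.
rewrite /B; lra.
Qed.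

Lemma star_shaped_total (R : realType) (X : completeNormedModType R)
  (F : R -> set X) (M : R) : separable X ->
  (forall t, F t !=set0) -> (forall t, compact (F t)) ->
  (forall t x, F t x -> `|x| <= M) -> star_shaped (riemann_limits F).
Proof.
move=> sepX F0 cF FM.
have [A0 [A00 clA0 A0P]] := riemann_star_center sepX F0 cF FM.
(* Compactness is what makes the Minkowski combination of [A0] and [A] closed. *)
have compact_limit A : riemann_limits F A -> compact A.
  move=> AF; have [_ clA _] := AF; apply: compact_hausdorff_approx => // e e0.
  have [P [_ [_ PA]]] := riemann_limitsE AF e0.
  by exists (riemann_sum F P) => //; exact: compact_riemann_sum.
have A0F : riemann_limits F A0.
  apply: riemann_limitsI => // e e0; have [d d0 dP] := A0P e e0.
  have [s' [s'p s'e]] := uniform_tagged_path (divr_gt0 d0 (ltr0n _ 2)).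
  have [P0 [P0m _]] := partition_of_tagged_path F0 (ltW (divr_gt0 d0 (ltr0n _ 2))) s'p s'e.
  (* For [l = 1] the contribution of [P0] disappears and only [A0] remains. *)
  have [||P [Pm PA]] := dP P0 1; [by lra|by rewrite lexx ler01|].
  exists P; split => //; move: PA.
  rewrite subrr minkowski_scale0; last exact: riemann_sum_neq0.
  rewrite minkowski_addC minkowski_add0s (_ : minkowski_scale 1 A0 = A0)//.
  by apply/seteqP; split=> [_ [a ? <-]|a ?]; [rewrite scale1r|exists a; rewrite ?scale1r].
exists A0 => // A AF l l01; have [A_0 _ _] := AF.
apply: riemann_limitsI => //.
- by apply: minkowski_add_neq0; exact: minkowski_scale_neq0.
- apply: compact_closed; first exact: norm_hausdorff.
  by apply: compact_minkowski_add; apply: compact_minkowski_scale; exact: compact_limit.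
move=> e e0; have e20 : 0 < e / 2 by rewrite divr_gt0.
have [d d0 dP] := A0P _ e20.
have r0 : 0 < Num.min d (e / 2) by rewrite lt_min d0.
have [P0 [+ P0A]] := riemann_limitsE AF r0; rewrite lt_min => /andP[P0d P0e].
have [P [Pm PA]] := dP P0 l P0d l01.
exists P; split; first by lra.
have /andP[l0 l1] := l01; have l1' : 0 <= 1 - l by lra.
apply: (hausdorff_le_mono _ (hausdorff_le_trans PA (hausdorff_leD
  (hausdorff_le_refl _ (lexx 0)) (hausdorff_leZ l1' P0A)))).
have : (1 - l) * Num.min d (e / 2) <= Num.min d (e / 2).
  by rewrite ler_piMl ?(ltW r0)// gerBl.
have : Num.min d (e / 2) <= e / 2 by rewrite ge_min lexx orbT.
lra.
Qed.

Theorem theorem4p3 (R : realType) (X : completeNormedModType R)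
  (sepX : separable X) (F : R -> set X)
  (F_multi : multifunction F) (F_compact : compact_valued F)
  (F_bounded : bounded_multifunction F) :
  star_shaped (riemann_limits F).
Proof.
(* Composing with the retraction onto the unit interval extends the hypotheses to all real [t] and
   preserves the Riemann sums, whose tags lie in that interval. *)
pose clip (t : R) := Num.max 0 (Num.min 1 t).
have clip01 t : 0 <= clip t <= 1.
  by rewrite /clip le_max lexx/= ge_max ler01 ge_min lexx.
have clipE t : 0 <= t <= 1 -> clip t = t.
  by move=> /andP[t0 t1]; rewrite /clip min_r// max_r.
have FE P : riemann_sum F P = riemann_sum (F \o clip) P.
  apply: eq_bigr => i _; rewrite /= clipE//.
  have /andP[h1 h2] := tp_tagP i; apply/andP; split.
    apply: le_trans h1; rewrite (set_nth_default 1) /= ?ltnS ?(ltnW (ltn_ord i))//.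
    by apply: itv_partition_nth_ge (tp_pointsP P); rewrite ltnS ltnW.
  apply: (le_trans h2); rewrite (set_nth_default 1)//.
  by apply: (@itv_partition_nth_le _ _ 0 1 (tp_points P) i.+1) (tp_pointsP P); rewrite ltnS.
have -> : riemann_limits F = riemann_limits (F \o clip).
  apply/seteqP; split=> A [A0 clA [P PP]]; split => //; exists P.
    by under [X in _ /\ (X @ _ --> _)]eq_fun do rewrite -FE.
  by under [X in _ /\ (X @ _ --> _)]eq_fun do rewrite FE.
have [M FM] : exists M, forall t x, F (clip t) x -> `|x| <= M.
  exists (fine (sup_norm F)) => t x Fx.
  have le : (`|x|%:E <= sup_norm F)%E.
    by apply: ereal_sup_ubound; exists x => //; exists (clip t) => //=.
  rewrite -lee_fin fineK// fin_numE -ltey F_bounded andbT.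
  by rewrite -ltNye (lt_le_trans _ le)// ltNyr.
apply: (@star_shaped_total _ _ _ M) => //.
- by move=> t; exact: F_multi.
- by move=> t; exact: F_compact.
Qed.
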